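(* Let $n\geq 1$, let $H$ be any graph, and let $S=K[V(K_n\odot H)]$. Then $$\operatorname{reg}(S/I(K_n\odot H))=\begin{cases}1, & \text{if } H \text{ is a null graph};\\ n\cdot\operatorname{reg}(K[V(H)]/I(H)), & \text{otherwise}.\end{cases}$$
   Context: $K$ is a field. All graphs are finite, simple, have nonempty vertex set, and may have isolated vertices. Vertices of a graph $G$ are identified with the variables of the standard graded polynomial ring $K[V(G)]$. A null graph is a graph with no edges. Edge ideal convention: $I(G)\subset K[V(G)]$ is the ideal generated by all products $x_ix_j$ with $\{x_i,x_j\}\in E(G)$ together with all variables $x_k$ with $x_k$ an isolated vertex of $G$. (Thus $K[V(H)]/I(H)\cong K[V(H')]/I(H')$, where $H'$ is the induced subgraph of $H$ on the non-isolated vertices.) The corona product $X\odot H$ is the graph obtained from one copy of $X$ and $|V(X)|$ disjoint copies of $H$, namely $H_1,\dots,H_{|V(X)|}$, by joining the $i$-th vertex of $X$ to every vertex of $H_i$. It has no isolated vertices, so $I(X\odot H)$ is the usual edge ideal. $K_n$ is the complete graph on $n$ vertices ($K_1$ is a single vertex). $\operatorname{reg}(A)=\max\{j-i:\beta_{i,j}(A)\neq0\}$ is the Castelnuovo–Mumford regularity, where $\beta_{i,j}(A)$ are the graded Betti numbers of the finitely generated graded module $A$ over the corresponding polynomial ring. *)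

(* Defs.v *)
From Stdlib Require Import ClassicalEpsilon.
From HB Require Import structures.
From mathcomp Require Import all_boot all_order all_algebra.
From mathcomp Require Import mpoly.

Set Implicit Arguments.
Unset Strict Implicit.
Unset Printing Implicit Defensive.

Import GRing.Theory Num.Theory.
Local Open Scope ring_scope.

(* Nonemptiness of the vertex set is not part of the structure; it is a
   hypothesis of the statements. *)
Record sgraph := SGraph {
  vertex :> finType;
  adj : rel vertex;
  adj_sym : ssrbool.symmetric adj;
  adj_irr : irreflexive adj }.

Definition isolated (G : sgraph) (v : G) : bool := [forall w, ~~ adj v w].

Definition null_graph (G : sgraph) : bool :=
  [forall v : G, forall w : G, ~~ adj v w].

Section Complete.
Variable n : nat.

Definition complete_adj : rel 'I_n := fun i j => i != j.

Fact complete_sym : ssrbool.symmetric complete_adj.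
Proof. by move=> i j; rewrite /complete_adj eq_sym. Qed.

Fact complete_irr : irreflexive complete_adj.
Proof. by move=> i; rewrite /complete_adj eqxx. Qed.

Definition complete_graph : sgraph := SGraph complete_sym complete_irr.
End Complete.

(* inl x is the vertex x of X; inr (x, h) is the vertex h of the copy of H
   attached to x. *)
Section Corona.
Variables X H : sgraph.

Definition corona_adj : rel (X + X * H)%type := fun a b =>
  match a, b with
  | inl x, inl y => adj x y
  | inl x, inr (y, _) => x == y
  | inr (x, _), inl y => x == y
  | inr (x, h), inr (y, k) => (x == y) && adj h k
  end.

Fact corona_sym : ssrbool.symmetric corona_adj.
Proof.
move=> [x|[x h]] [y|[y k]] /=; first exact: adj_sym.
- exact: eq_sym.
- exact: eq_sym.
- by rewrite eq_sym adj_sym.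
Qed.

Fact corona_irr : irreflexive corona_adj.
Proof. by move=> [x|[x h]] /=; rewrite adj_irr ?andbF. Qed.

Definition corona : sgraph := SGraph corona_sym corona_irr.
End Corona.

Definition ideal_gen (R : comNzRingType) (B : R -> Prop) (p : R) : Prop :=
  exists2 s : seq (R * R),
    (forall t, t \in s -> B t.2) & p = \sum_(t <- s) t.1 * t.2.

(* The polynomial ring K[V(G)] is {mpoly K[#|G|]}, with v corresponding to the
   variable of index enum_rank v. *)
Definition gvar (K : fieldType) (G : sgraph) (v : G) : {mpoly K[#|G|]} :=
  'X_(enum_rank v).

Definition edge_ideal (K : fieldType) (G : sgraph) : {mpoly K[#|G|]} -> Prop :=
  ideal_gen (fun p =>
    (exists u v : G, adj u v /\ p = gvar K u * gvar K v) \/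
    (exists v : G, isolated v /\ p = gvar K v)).
Arguments edge_ideal K G p : clear implicits.

Section Resolutions.
Variables (K : fieldType) (m : nat).
Local Notation S := {mpoly K[m]}.

(* F_i = \bigoplus_k S(- shift i k), elements being row vectors, with maps
     ... -> F_2 --diff 1--> F_1 --diff 0--> F_0 --aug--> S
   acting by right multiplication; aug is to be read modulo an ideal. Natural
   numbers suffice for the shifts, as S/I lives in nonnegative degrees. *)
Record free_sequence := FreeSequence {
  rank : nat -> nat;
  shift : forall i, 'I_(rank i) -> nat;
  diff : forall i, 'M[S]_(rank i.+1, rank i);
  aug : 'cV[S]_(rank 0) }.

Definition graded_maps (F : free_sequence) : Prop :=
  (forall k (u : 'X_{1..m}), u \in msupp (aug F k ord0) ->
     mdeg u = shift k) /\
  (forall i k l (u : 'X_{1..m}), u \in msupp (diff F i k l) ->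
     (mdeg u + shift l)%N = shift k).

(* ... -> F_1 -> F_0 -> S/I -> 0 is exact *)
Definition resolves (I : S -> Prop) (F : free_sequence) : Prop :=
  [/\ forall p : S, exists v : 'rV_(rank F 0),
        I (p - (v *m aug F) ord0 ord0),
      forall v : 'rV_(rank F 0),
        I ((v *m aug F) ord0 ord0) <-> exists w, v = w *m diff F 0
    & forall i (v : 'rV_(rank F i.+1)),
        v *m diff F i = 0 <-> exists w, v = w *m diff F i.+1].

(* im (F_{i+1} -> F_i) is contained in (x_1, ..., x_m) F_i *)
Definition minimal (F : free_sequence) : Prop :=
  forall i k l, (diff F i k l)@_0%MM = 0.

Definition min_graded_free_resolution (I : S -> Prop) (F : free_sequence) :=
  [/\ graded_maps F, resolves I F & minimal F].

Definition zero_sequence : free_sequence :=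
  @FreeSequence (fun=> 0%N) (fun _ _ => 0%N) (fun=> 0) 0.

(* For a homogeneous ideal I, a minimal graded free resolution of S/I exists
   and is unique up to isomorphism, so the choice is immaterial; the value for
   other I is junk. *)
Definition min_resolution (I : S -> Prop) : free_sequence :=
  epsilon (inhabits zero_sequence) (min_graded_free_resolution I).

(* beta_{i,j}(S/I) *)
Definition betti (I : S -> Prop) (i j : nat) : nat :=
  #|[set k : 'I_(rank (min_resolution I) i) | shift k == j]|.

Definition is_max (A : int -> Prop) (r : int) : Prop :=
  A r /\ forall s, A s -> s <= r.

(* reg(S/I), not reg(I); the maximum exists for I homogeneous and proper, by
   Hilbert's syzygy theorem. *)
Definition reg (I : S -> Prop) : int :=
  epsilon (inhabits 0) (is_max (fun r =>
    exists i j : nat, betti I i j != 0%N /\ r = j%:Z - i%:Z)).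
End Resolutions.

(* Main.v *)
Require Import Defs.
From Stdlib Require Import ClassicalEpsilon.
From Stdlib Require FunctionalExtensionality PropExtensionality.
From HB Require Import structures.
From mathcomp Require Import all_boot all_order all_algebra.
From mathcomp Require Import ring zify.
From mathcomp Require Import mpoly.

Set Implicit Arguments.
Unset Strict Implicit.
Unset Printing Implicit Defensive.

Import GRing.Theory Num.Theory.
Local Open Scope ring_scope.

(** Write reg for the regularity of the quotient by an ideal. Put the corona
    ideal in S, let x_1, ..., x_n be the clique vertices and let J_k be the sum
    of the edge ideal and of x_1, ..., x_k. In J_n all clique vertices vanish
    and n disjoint copies of the edges of H remain, so reg J_n = n s where s is
    the regularity of H: regularity is additive over disjoint sets of variables.
    For x = x_(k+1), the colon ideal of J_k by x contains all other clique
    vertices and the whole copy of H at x, so that n - 1 copies of H remain and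
    its regularity is (n - 1) s. The exact sequence

      0 -> S/(J_k : x)(-1) -> S/J_k -> S/J_(k+1) -> 0

    gives reg J_k <= max ((n - 1) s + 1, n s) by the horseshoe lemma
    ([regle_colon]) and n s <= max ((n - 1) s, reg J_k) by the mapping cone
    ([regle_sum]). If H has an edge then s >= 1 ([regle0_edges]), both
    inequalities together give reg J_k = n s, and descending from k = n to 0
    yields the result ([hasreg_prefix]). If H has no edge, the colon ideals are
    generated by variables, so the first inequality gives reg J_0 <= 1, and
    reg J_0 is not 0 because the ideal is generated by quadrics. Isolated
    vertices of H, which are variables of its own edge ideal but free variables
    next to the copies, do not change s ([hasreg_edge_ideal]).

    To speak of the regularity, resolutions are finite complexes of based free
    modules. Every monomial ideal at hand has one, built from horseshoes and
    cones ([regle_graph]), and cancelling the unit entries of its differential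
    makes it minimal ([minimize]). Two minimal graded resolutions have the same
    shifts, because the comparison maps between them compose to the identity
    modulo the variables ([minimal_shift]); hence a minimal resolution computes
    [reg] ([hasreg_reg]), and any resolution bounds it ([hasreg_min]).

    Additivity ([hasreg_tensor]) holds because the tensor product of minimal
    resolutions is minimal. Its exactness ([tensor_resolution]) needs one
    resolution to stay exact modulo the other ideal. This is the case since S/I,
    for a monomial ideal I in a part of the variables, is free over the
    polynomial ring in the other variables ([base_change_exact]). *)

(** * Homogeneous polynomials and monomial ideals *)

Lemma choose_fun (A B : Type) (P : A -> B -> Prop) :
  (forall a, exists b, P a b) -> exists f, forall a, P a (f a).
Proof.
move=> h; exists (fun a => proj1_sig (constructive_indefinite_description _ (h a))).
by move=> a; case: constructive_indefinite_description.
Qed.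

Section Homogeneity.
Variables (R : comNzRingType) (m : nat).
Local Notation S := {mpoly R[m]}.
Implicit Types (p q : S) (u v : 'X_{1..m}).

(** The entries of a graded map between free modules: p sends a generator of
    degree s to a multiple of one of degree t. Writing the condition without
    the difference s - t makes p = 0 the only choice when s < t. *)
Definition isdeg p s t := forall u, p@_u != 0 -> (mdeg u + t)%N = s.

Lemma isdeg0 s t : isdeg 0 s t.
Proof. by move=> u; rewrite mcoeff0 eqxx. Qed.

Lemma isdegN p s t : isdeg p s t -> isdeg (- p) s t.
Proof. by move=> hp u; rewrite mcoeffN oppr_eq0; apply: hp. Qed.

Lemma isdegD p q s t : isdeg p s t -> isdeg q s t -> isdeg (p + q) s t.
Proof.
move=> hp hq u; rewrite mcoeffD.
have [p0|pn] := eqVneq p@_u 0; last by move=> _; apply: hp.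
by rewrite p0 add0r; apply: hq.
Qed.

Lemma isdeg_sum (T : Type) (r : seq T) (P : pred T) (F : T -> S) s t :
  (forall i, P i -> isdeg (F i) s t) -> isdeg (\sum_(i <- r | P i) F i) s t.
Proof.
by move=> h; apply: (big_ind (fun p => isdeg p s t)) => //;
  [exact: isdeg0 | move=> p q; apply: isdegD].
Qed.

Lemma mcoeffM_neq0 p q u : (p * q)@_u != 0 ->
  exists v w, [/\ p@_v != 0, q@_w != 0 & u = (v + w)%MM].
Proof.
rewrite -mcoeff_msupp => /msuppM_le /allpairsP[[v w] /= [hv hw ->]].
by exists v, w; rewrite -!mcoeff_msupp.
Qed.

Lemma isdegM p q s t r : isdeg p s t -> isdeg q t r -> isdeg (p * q) s r.
Proof.
move=> hp hq u /mcoeffM_neq0[v [w [/hp <- /hq <- ->]]].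
by rewrite mdegD addnA.
Qed.

Lemma isdegC (c : R) s : isdeg c%:MP s s.
Proof. by move=> u; rewrite mcoeffC; case: (u =P 0%MM) => [->|]; rewrite ?mdeg0 ?mulr0 ?eqxx. Qed.

Lemma isdegX u s t : (mdeg u + t)%N = s -> isdeg 'X_[u] s t.
Proof. by move=> h v; rewrite mcoeffX; case: (u =P v) => [<-|]; rewrite ?eqxx. Qed.

Lemma isdeg_shift p s t k : isdeg p s t -> isdeg p (s + k) (t + k).
Proof. by move=> hp u /hp <-; rewrite addnA. Qed.

Definition mrestr (P : pred 'X_{1..m}) p : S :=
  \sum_(u <- msupp p | P u) p@_u *: 'X_[u].

Lemma mrestrE (P : pred 'X_{1..m}) p u :
  (mrestr P p)@_u = if P u then p@_u else 0.
Proof.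
rewrite {2}[p]mpolyE /mrestr !raddf_sum /= big_mkcond /=.
case: ifP => hu.
  apply: eq_bigr => v _; case: ifP => // hv.
  rewrite mcoeffZ mcoeffX; case: (v =P u) => [e|]; rewrite ?mulr0 //.
  by rewrite e hu in hv.
apply: big1 => v _; case: ifP => hv //.
rewrite mcoeffZ mcoeffX; case: (v =P u) => [e|]; rewrite ?mulr0 //.
by rewrite e hu in hv.
Qed.

Definition hcomp (s t : nat) p : S := mrestr (fun u => mdeg u + t == s)%N p.

Lemma hcompE s t p u : (hcomp s t p)@_u = if (mdeg u + t == s)%N then p@_u else 0.
Proof. exact: mrestrE. Qed.

Lemma hcomp_isdeg s t p : isdeg (hcomp s t p) s t.
Proof. by move=> u; rewrite hcompE; case: (_ =P s) => //; rewrite eqxx. Qed.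

Lemma hcomp_id s t p : isdeg p s t -> hcomp s t p = p.
Proof.
move=> hp; apply/mpolyP => u; rewrite hcompE; case: (_ =P s) => // hu.
by have [->|/hp] := eqVneq p@_u 0.
Qed.

Lemma hcomp_is_additive s t : {morph hcomp s t : p q / p + q}.
Proof.
move=> p q; apply/mpolyP => u; rewrite mcoeffD !hcompE mcoeffD.
by case: ifP; rewrite ?addr0.
Qed.

Lemma hcompB s t : {morph hcomp s t : p q / p - q}.
Proof.
move=> p q; apply/mpolyP => u; rewrite mcoeffB !hcompE mcoeffB.
by case: ifP; rewrite ?subr0.
Qed.

Lemma hcomp0 s t : hcomp s t 0 = 0.
Proof. by apply/mpolyP => u; rewrite hcompE mcoeff0 if_same. Qed.

Lemma hcomp_sum (T : Type) (l : seq T) (P : pred T) (F : T -> S) s t :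
  hcomp s t (\sum_(i <- l | P i) F i) = \sum_(i <- l | P i) hcomp s t (F i).
Proof. exact: (big_morph _ (hcomp_is_additive s t) (hcomp0 s t)). Qed.

(** Only the component of [p] of degree [s - t] can contribute: both factors
    being split into homogeneous parts, degrees add up. *)
Lemma hcompM s t r p q : isdeg q t r -> hcomp s r (p * q) = hcomp s t p * q.
Proof.
move=> hq; pose p' := p - hcomp s t p.
have hp' : hcomp s r (p' * q) = 0.
  apply/mpolyP => u; rewrite hcompE mcoeff0; case: (_ =P s) => // hu.
  apply/eqP/negP => /negP /mcoeffM_neq0[v [w [hv /hq hw eu]]].
  move: hv; rewrite mcoeffB hcompE.
  by rewrite -hu eu mdegD -hw addnA eqxx subrr eqxx.
have ep : p = hcomp s t p + p' by rewrite /p' addrC subrK.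
rewrite {1}ep mulrDl hcomp_is_additive hp' addr0 hcomp_id //.
by apply: isdegM hq; apply: hcomp_isdeg.
Qed.
End Homogeneity.

Section Ideals.
Variables (R : comNzRingType).

Definition is_ideal (I : R -> Prop) :=
  [/\ I 0, forall p q, I p -> I q -> I (p + q) & forall a p, I p -> I (a * p)].

Lemma ideal0 I : is_ideal I -> I 0. Proof. by case. Qed.
Lemma idealD I p q : is_ideal I -> I p -> I q -> I (p + q).
Proof. by case=> _ h _; apply: h. Qed.
Lemma idealM I a p : is_ideal I -> I p -> I (a * p).
Proof. by case=> _ _; apply. Qed.
Lemma idealN I p : is_ideal I -> I p -> I (- p).
Proof. by move=> hI hp; rewrite -mulN1r; apply: idealM. Qed.
Lemma idealB I p q : is_ideal I -> I p -> I q -> I (p - q).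
Proof. by move=> hI hp hq; apply: idealD => //; apply: idealN. Qed.
Lemma ideal_sum I (T : Type) (r : seq T) (P : pred T) (F : T -> R) :
  is_ideal I -> (forall i, P i -> I (F i)) -> I (\sum_(i <- r | P i) F i).
Proof.
move=> hI hF; apply: (big_ind I) => //; first exact: ideal0.
by move=> p q; apply: idealD.
Qed.
Lemma ideal_congr I p q : is_ideal I -> I (p - q) -> I q -> I p.
Proof. by move=> hI h1 h2; rewrite -(subrK q p); apply: idealD. Qed.
End Ideals.

Section MonomialIdeals.
Variables (R : comNzRingType) (m : nat).
Local Notation S := {mpoly R[m]}.
Implicit Types (p q : S) (u v : 'X_{1..m}) (Q : pred 'X_{1..m}).

Definition upset Q := forall u v, Q u -> Q (u + v)%MM.

(** Monomial ideals are handled through the set of their monomials: colon ideals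
    by monomials and sums then become operations on predicates. *)
Definition mideal Q p : Prop := forall u, p@_u != 0 -> Q u.

Lemma mideal_ideal Q : upset Q -> is_ideal (mideal Q).
Proof.
move=> hQ; split.
- by move=> u; rewrite mcoeff0 eqxx.
- move=> p q hp hq u; rewrite mcoeffD.
  have [->|/hp //] := eqVneq p@_u 0.
  by rewrite add0r; apply: hq.
- move=> a p hp u /mcoeffM_neq0[v [w [_ /hp hw ->]]].
  by rewrite addmC; apply: hQ.
Qed.

Lemma mideal_hcomp Q p s t : mideal Q p -> mideal Q (hcomp s t p).
Proof. by move=> hp u; rewrite hcompE; case: (_ =P s) => _; [apply: hp|rewrite eqxx]. Qed.

Lemma midealX Q u : Q u -> mideal Q ('X_[u] : S).
Proof. by move=> hu v; rewrite mcoeffX; case: (u =P v) => [<-|]; rewrite ?eqxx. Qed.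

Lemma midealMX Q x p : mideal Q ('X_[x] * p) <-> mideal [pred u | Q (x + u)%MM] p.
Proof.
rewrite mulrC; split=> h u; rewrite /=.
  by rewrite -(mcoeffMX p x u); apply: h.
move=> /mcoeffM_neq0[v [w [hv]]].
rewrite mcoeffX; case: (x =P w) => [<-|]; last by rewrite eqxx.
by move=> _ ->; rewrite addmC; apply: h.
Qed.

Lemma mideal_sub Q1 Q2 p : (forall u, Q1 u -> Q2 u) -> mideal Q1 p -> mideal Q2 p.
Proof. by move=> h hp u /hp /h. Qed.

(** The terms of p divisible by x are collected in the multiple of x. *)
Lemma midealD_var Q x p :
  mideal [pred u | Q u || (x <= u)%MM] p <-> exists q, mideal Q (p - 'X_[x] * q).
Proof.
split=> [hp|[q hq] u hu]; last first.
  rewrite inE; have [e|/hq -> //] := eqVneq (p - 'X_[x] * q)@_u 0.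
  have : ('X_[x] * q)@_u != 0.
    by move: e; rewrite mcoeffB => /subr0_eq <-.
  move=> /mcoeffM_neq0[v [w []]]; rewrite mcoeffX.
  case: (x =P v) => [<- _ _ ->|]; last by rewrite eqxx.
  by rewrite lem_addr orbT.
exists (\sum_(u <- msupp p | (x <= u)%MM) p@_u *: 'X_[(u - x)]).
suff -> : 'X_[x] * (\sum_(u <- msupp p | (x <= u)%MM) p@_u *: 'X_[u - x])
        = mrestr (fun u => (x <= u)%MM) p.
  move=> u; rewrite mcoeffB mrestrE.
  case: ifP => hxu; first by rewrite subrr eqxx.
  by rewrite subr0 => /hp /=; rewrite hxu orbF.
rewrite mulr_sumr; apply: eq_bigr => u hu.
by rewrite -scalerAr -mpolyXD addmC submK.
Qed.
End MonomialIdeals.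

(** * Finite complexes of based free modules *)

Section Dot.
Variables (R : comNzRingType).

Definition dot (T : finType) (v f : T -> R) := \sum_b v b * f b.

Lemma eq_dot (T : finType) (v w f : T -> R) : v =1 w -> dot v f = dot w f.
Proof. by move=> h; apply: eq_bigr => b _; rewrite h. Qed.

Lemma eq_dotr (T : finType) (v f g : T -> R) : f =1 g -> dot v f = dot v g.
Proof. by move=> h; apply: eq_bigr => b _; rewrite h. Qed.

Lemma dot_eq0 (T : finType) (v f : T -> R) :
  (forall b, v b != 0 -> f b = 0) -> dot v f = 0.
Proof.
move=> h; apply: big1 => b _; have [->|/h ->] := eqVneq (v b) 0.
  by rewrite mul0r.
by rewrite mulr0.
Qed.

Lemma dotD (T : finType) (v w f : T -> R) :
  dot (fun b => v b + w b) f = dot v f + dot w f.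
Proof. by rewrite /dot -big_split; apply: eq_bigr => b _; rewrite mulrDl. Qed.

Lemma dotZ (T : finType) a (v f : T -> R) : dot (fun b => a * v b) f = a * dot v f.
Proof. by rewrite /dot mulr_sumr; apply: eq_bigr => b _; rewrite mulrA. Qed.

Lemma dotN (T : finType) (v f : T -> R) : dot (fun b => - v b) f = - dot v f.
Proof. by rewrite /dot -sumrN; apply: eq_bigr => b _; rewrite mulNr. Qed.

Lemma dotB (T : finType) (v w f : T -> R) :
  dot (fun b => v b - w b) f = dot v f - dot w f.
Proof. by rewrite dotD dotN. Qed.

Lemma dotDr (T : finType) (v f g : T -> R) :
  dot v (fun b => f b + g b) = dot v f + dot v g.
Proof. by rewrite /dot -big_split; apply: eq_bigr => b _; rewrite mulrDr. Qed.

Lemma dotNr (T : finType) (v f : T -> R) : dot v (fun b => - f b) = - dot v f.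
Proof. by rewrite /dot -sumrN; apply: eq_bigr => b _; rewrite mulrN. Qed.

Lemma dotBr (T : finType) (v f g : T -> R) :
  dot v (fun b => f b - g b) = dot v f - dot v g.
Proof. by rewrite dotDr dotNr. Qed.

Lemma dotZr (T : finType) a (v f : T -> R) : dot v (fun b => a * f b) = a * dot v f.
Proof. by rewrite /dot mulr_sumr; apply: eq_bigr => b _; rewrite mulrCA. Qed.

Lemma dot0 (T : finType) (f : T -> R) : dot (fun=> 0) f = 0.
Proof. by apply: big1 => b _; rewrite mul0r. Qed.

Lemma dot0r (T : finType) (f : T -> R) : dot f (fun=> 0) = 0.
Proof. by apply: big1 => b _; rewrite mulr0. Qed.

Lemma dot_delta (T : finType) (c : T) (f : T -> R) : dot (fun b => (b == c)%:R) f = f c.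
Proof.
rewrite /dot (bigD1 c) //= eqxx mul1r big1 ?addr0 // => b /negbTE ->.
by rewrite mul0r.
Qed.

Lemma dot_dot (T U : finType) (v : T -> R) (M : T -> U -> R) (f : U -> R) :
  dot (fun c => dot v (fun b => M b c)) f = dot v (fun b => dot (M b) f).
Proof.
rewrite /dot; under eq_bigr do rewrite mulr_suml.
rewrite exchange_big; apply: eq_bigr => b _ /=.
by rewrite mulr_sumr; apply: eq_bigr => c _; rewrite mulrA.
Qed.

Lemma ideal_dot I (T : finType) (v f : T -> R) :
  is_ideal I -> (forall b, v b != 0 -> I (f b)) -> I (dot v f).
Proof.
move=> hI h; apply: ideal_sum => // b _; have [->|/h] := eqVneq (v b) 0.
  by rewrite mul0r; apply: ideal0.
exact: idealM.
Qed.
End Dot.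

Section Complexes.
Variables (K : fieldType) (m : nat).
Local Notation S := {mpoly K[m]}.

(** One finite type indexes the generators of all homological degrees, [hdeg]
    being the homological and [tdeg] the internal degree, so that the
    differential is a single square matrix and no type depends on a degree. *)
Record based_complex := BasedComplex {
  basis :> finType;
  hdeg : basis -> nat;
  tdeg : basis -> nat;
  bd : basis -> basis -> S;
  baug : basis -> S }.

(** Chains are functions on the basis, seen as row vectors: the differential acts
    on them by multiplication on the right. *)
Definition dif (X : based_complex) (v : X -> S) (c : X) := dot v (fun b => bd b c).
Definition eps (X : based_complex) (v : X -> S) := dot v (@baug X).

Definition graded_bd (X : based_complex) :=
  (forall b c : X, bd b c != 0 -> hdeg b = (hdeg c).+1) /\
  (forall b c : X, isdeg (bd b c) (tdeg b) (tdeg c)).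

Definition graded (X : based_complex) :=
  [/\ graded_bd X,
      forall b : X, baug b != 0 -> hdeg b = 0%N
    & forall b : X, isdeg (baug b) (tdeg b) 0].

(** Exactness in all homological degrees at once. As the differential lowers
    [hdeg] by one and [baug] vanishes outside degree 0, this is the same as
    exactness degree by degree. *)
Definition acyclic (I : S -> Prop) (X : based_complex) :=
  [/\ forall b c : X, dif (bd b) c = 0,
      forall b : X, I (eps (bd b))
    & forall v : X -> S, (forall c, dif v c = 0) -> I (eps v) ->
        exists w, forall c, v c = dif w c].

Definition resolution (I : S -> Prop) (X : based_complex) :=
  acyclic I X /\ exists e : X -> S, I (1 - eps e).

Definition hom_ideal (I : S -> Prop) :=
  is_ideal I /\ forall p s t, I p -> I (hcomp s t p).

Lemma mideal_hom Q : upset Q -> hom_ideal (@mideal K m Q).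
Proof. by move=> hQ; split; [apply: mideal_ideal | move=> p s t; apply: mideal_hcomp]. Qed.

Definition hvec (X : based_complex) h s (v : X -> S) :=
  forall b, (v b != 0 -> hdeg b = h) /\ isdeg (v b) s (tdeg b).

Definition prj (X : based_complex) h s (v : X -> S) b :=
  if hdeg b == h then hcomp s (tdeg b) (v b) else 0.

Lemma prj_hvec (X : based_complex) h s (v : X -> S) : hvec h s (prj h s v).
Proof.
move=> b; rewrite /prj; case: (hdeg b =P h) => hb; split=> //.
- exact: hcomp_isdeg.
- by rewrite eqxx.
- exact: isdeg0.
Qed.

Lemma prj_id (X : based_complex) h s (v : X -> S) : hvec h s v -> prj h s v =1 v.
Proof.
move=> hv b; rewrite /prj; case: (hv b) => h1 h2; case: (hdeg b =P h) => hb.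
  exact: hcomp_id.
by have [//|/h1] := eqVneq (v b) 0.
Qed.

Lemma dif_prj (X : based_complex) h s (v : X -> S) c : graded_bd X ->
  dif (prj h.+1 s v) c = prj h s (dif v) c.
Proof.
move=> [hX1 hX2]; rewrite /dif /dot /prj.
case: (hdeg c =P h) => hc.
  rewrite hcomp_sum; apply: eq_bigr => b _.
  rewrite (hcompM _ _ (hX2 b c)).
  have [->|/hX1 ->] := eqVneq (bd b c) 0; first by rewrite !mulr0.
  by rewrite hc eqxx.
apply: big1 => b _; have [->|/hX1 ->] := eqVneq (bd b c) 0; first by rewrite mulr0.
by rewrite eqSS; case: eqP => //; rewrite mul0r.
Qed.

Lemma eps_prj (X : based_complex) h s (v : X -> S) : graded X ->
  eps (prj h s v) = if h == 0%N then hcomp s 0 (eps v) else 0.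
Proof.
move=> [_ hX1 hX2]; rewrite /eps /dot /prj.
case: eqP => hh.
  rewrite hcomp_sum; apply: eq_bigr => b _.
  rewrite (hcompM _ _ (hX2 b)).
  have [->|/hX1 ->] := eqVneq (baug b) 0; first by rewrite !mulr0.
  by rewrite hh eqxx.
apply: big1 => b _; have [->|/hX1 ->] := eqVneq (baug b) 0; first by rewrite mulr0.
by case: eqP => // e; [case: hh | rewrite mul0r].
Qed.

Lemma dif_hvec0 (X : based_complex) s (v : X -> S) c : graded_bd X ->
  hvec 0 s v -> dif v c = 0.
Proof.
move=> [hX _] hv; apply: dot_eq0 => b /(hv b).1 hb.
by apply/eqP/negP => /negP /hX; rewrite hb.
Qed.

Lemma eps_hvecS (X : based_complex) h s (v : X -> S) : graded X ->
  hvec h.+1 s v -> eps v = 0.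
Proof.
move=> [_ hX _] hv; apply: dot_eq0 => b /(hv b).1 hb.
by apply/eqP/negP => /negP /hX; rewrite hb.
Qed.

Lemma exact_hvec I (X : based_complex) h s (v : X -> S) : graded X -> acyclic I X ->
  hvec h s v -> (forall c, dif v c = 0) -> I (eps v) ->
  exists2 w, hvec h.+1 s w & forall c, v c = dif w c.
Proof.
move=> gX [_ _ hex] hv dv ev; have [w hw] := hex v dv ev.
exists (prj h.+1 s w); first exact: prj_hvec.
move=> c; rewrite dif_prj; last by case: gX.
by rewrite -(prj_id hv) /prj hw.
Qed.

(** The class of 1 in S/I, lifted to the generators of degree 0. *)
Lemma unit_hvec I (X : based_complex) : graded X -> resolution I X -> hom_ideal I ->
  exists2 e : X -> S, hvec 0 0 e & I (1 - eps e).
Proof.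
move=> gX [_ [e he]] [_ hI]; exists (prj 0 0 e); first exact: prj_hvec.
rewrite eps_prj //=.
have -> : 1 - hcomp 0 0 (eps e) = hcomp 0 0 (1 - eps e); last exact: hI.
apply/mpolyP => u; rewrite mcoeffB !hcompE mcoeffB mcoeff1.
case: (_ =P 0%N) => hu //; rewrite subr0; case: eqP => // u0.
by case: hu; rewrite u0 mdeg0.
Qed.

(** The comparison construction: since the target is exact, the images of the
    generators can be chosen one homological degree after the other, the
    obstruction at each step being a cycle. *)
Lemma lift_chain_map (I : S -> Prop) (X Y : based_complex) (g : Y -> S) :
  hom_ideal I -> graded X -> acyclic I X ->
  graded_bd Y -> (forall y z : Y, dif (bd y) z = 0) ->
  (forall y, g y != 0 -> hdeg y = 1%N) -> (forall y, isdeg (g y) (tdeg y) 0) ->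
  (forall y, I (dot (bd y) g)) -> (forall y, exists w : X -> S, I (g y - eps w)) ->
  exists t : Y -> X -> S,
    [/\ forall y x, t y x != 0 -> hdeg y = (hdeg x).+1,
        forall y x, isdeg (t y x) (tdeg y) (tdeg x),
        forall y x, dif (t y) x + dot (bd y) (fun z => t z x) = 0
      & forall y, I (eps (t y) - g y)].
Proof.
move=> hI gX rX [gY1 gY2] ddY g1 g2 dg sg; have iI := hI.1.
pose good (t : Y -> X -> S) y :=
  [/\ forall x, t y x != 0 -> hdeg y = (hdeg x).+1,
      forall x, isdeg (t y x) (tdeg y) (tdeg x),
      forall x, dif (t y) x + dot (bd y) (fun z => t z x) = 0
    & I (eps (t y) - g y)].
suff H N : exists t, forall y, (hdeg y < N)%N -> good t y.
  have [t ht] := H (\max_(y : Y) hdeg y).+1.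
  have {}ht y : good t y by apply: ht; rewrite ltnS; apply: (leq_bigmax y).
  by exists t; split=> y; case: (ht y).
elim: N => [|N [t ht]]; first by exists (fun _ _ => 0).
suff H y : exists w : X -> S, hdeg y = N ->
  [/\ forall x, w x != 0 -> N = (hdeg x).+1,
      forall x, isdeg (w x) (tdeg y) (tdeg x),
      forall x, dif w x + dot (bd y) (fun z => t z x) = 0
    & I (eps w - g y)].
  have [w hw] := choose_fun H.
  exists (fun y => if hdeg y == N then w y else t y) => y.
  have E x : dot (bd y) (fun z => (if hdeg z == N then w z else t z) x)
      = dot (bd y) (fun z => t z x) \/ (N < hdeg y)%N.
    case: (ltnP N (hdeg y)) => hy; first by right.
    left; rewrite /dot; apply: eq_bigr => z _; have [->|/gY1 e] := eqVneq (bd y z) 0.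
      by rewrite !mul0r.
    by rewrite ifN // neq_ltn -e hy.
  rewrite ltnS leq_eqVlt => /predU1P[hy|hy].
    have [h1 h2 h3 h4] := hw y hy; rewrite /good hy eqxx; split=> // x.
    by case: (E x) => [->//|]; rewrite hy ltnn.
  have [h1 h2 h3 h4] := ht y hy; rewrite /good (ltn_eqF hy); split=> // x.
  by case: (E x) => [->//|]; rewrite ltnNge (ltnW hy).
case: (hdeg y =P N) => hy; last by exists (fun=> 0).
case: N => [|[|N]] in ht hy *.
- exists (fun=> 0) => _; have g0 : g y = 0.
    by apply/eqP/negP => /negP /g1; rewrite hy.
  split=> [x|x|x|]; [by rewrite eqxx | exact: isdeg0 | | ].
  + rewrite /dif dot0 add0r; apply: big1 => z _.
    have [->|/gY1] := eqVneq (bd y z) 0; [by rewrite mul0r | by rewrite hy].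
  + by rewrite /eps dot0 g0 subrr; apply: ideal0.
- have [e he] := sg y; have pe := @prj_hvec X 0 (tdeg y) e.
  exists (prj 0 (tdeg y) e) => _; split=> [x|x|x|].
  + by move=> /(pe x).1 ->.
  + by case: (pe x).
  + rewrite (dif_hvec0 _ _ pe); last by case: gX.
    rewrite add0r; apply: big1 => z _.
    have [->|/gY1 hz] := eqVneq (bd y z) 0; first by rewrite mul0r.
    have z0 : hdeg z = 0%N by move: hz; rewrite hy => -[].
    have [|tz _ _ _] := ht z; first by rewrite z0.
    have [->|/tz] := eqVneq (t z x) 0; [by rewrite mulr0 | by rewrite z0].
  + rewrite eps_prj //= -opprB; apply: idealN => //.
    rewrite -(hcomp_id (g2 y)) -hcompB; exact: hI.2.
- have g0 : g y = 0 by apply/eqP/negP => /negP /g1; rewrite hy.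
  have hz z : bd y z != 0 -> hdeg z = N.+1 by move=> /gY1; rewrite hy => -[].
  have tz z : bd y z != 0 -> good t z by move=> /hz e; apply: ht; rewrite e.
  pose f x := - dot (bd y) (fun z => t z x).
  have f1 : hvec N (tdeg y) f.
    move=> x; split.
      apply: contra_neq_eq => hx; rewrite /f dot_eq0 ?oppr0 // => z nz.
      have [t1 _ _ _] := tz z nz.
      apply/eqP/negP => /negP /t1; rewrite (hz z nz) => -[e].
      by rewrite e eqxx in hx.
    apply: isdegN; apply: isdeg_sum => z _.
    have [->|nz] := eqVneq (bd y z) 0; first by rewrite mul0r; apply: isdeg0.
    by apply: isdegM (gY2 y z) _; case: (tz z nz).
  have f2 c : dif f c = 0.
    rewrite /dif /f dotN dot_dot.
    rewrite (_ : dot _ _ = - dot (bd y) (fun z => dot (bd z) (fun z' => t z' c))).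
      rewrite opprK -dot_dot dot_eq0 // => z'; case/negP; apply/eqP.
      exact: ddY.
    rewrite -dotNr; apply: eq_bigr => z _.
    have [->|nz] := eqVneq (bd y z) 0; first by rewrite !mul0r.
    have [_ _ /(_ c) /eqP e _] := tz z nz.
    by rewrite addr_eq0 in e; rewrite -(eqP e).
  have f3 : I (eps f).
    rewrite /eps /f dotN dot_dot; apply: idealN => //.
    apply: (ideal_congr (q := dot (bd y) g)) => //.
    rewrite -dotBr; apply: ideal_dot => // z nz.
    by case: (tz z nz).
  have [w hw1 hw2] := exact_hvec gX rX f1 f2 f3.
  exists w => _; split.
  + by move=> x /(hw1 x).1 ->.
  + by move=> x; case: (hw1 x).
  + by move=> x; rewrite -hw2 /f addNr.
  + by rewrite (eps_hvecS gX hw1) g0 subrr; apply: ideal0.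
Qed.
End Complexes.

(** * Horseshoe and mapping cone for a colon ideal *)

Section Extensions.
Variables (K : fieldType) (m : nat).
Local Notation S := {mpoly K[m]}.
Implicit Types (X Y : based_complex K m) (I : S -> Prop).

Definition ext_bd X Y (t : Y -> X -> S) (b c : X + Y) : S :=
  match b, c with
  | inl x, inl x' => bd x x'
  | inl x, inr y => 0
  | inr y, inl x => t y x
  | inr y, inr y' => bd y y'
  end.

Definition extension X Y (t : Y -> X -> S) : based_complex K m :=
  @BasedComplex K m (X + Y)%type
    (fun b => match b with inl x => hdeg x | inr y => hdeg y end)
    (fun b => match b with inl x => tdeg x | inr y => tdeg y end)
    (ext_bd t)
    (fun b => match b with inl x => baug x | inr y => baug y end).

Lemma dot_sum (T U : finType) (v f : T + U -> S) :
  dot v f = dot (v \o inl) (f \o inl) + dot (v \o inr) (f \o inr).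
Proof. exact: big_sumType. Qed.

Lemma dif_extl X Y t (v : @extension X Y t -> S) x :
  dif v (inl x) = dif (v \o inl) x + dot (v \o inr) (fun y => t y x).
Proof. by rewrite /dif dot_sum. Qed.

Lemma dif_extr X Y t (v : @extension X Y t -> S) y :
  dif v (inr y) = @dif _ _ Y (v \o inr) y.
Proof. by rewrite /dif dot_sum (dot0r (v \o inl)) add0r. Qed.

Lemma eps_ext X Y t (v : @extension X Y t -> S) :
  eps v = eps (v \o inl) + @eps _ _ Y (v \o inr).
Proof. by rewrite /eps dot_sum. Qed.

(** The condition on t says that the off-diagonal block anticommutes with the
    differentials; it is the one that [lift_chain_map] provides. *)
Lemma extension_bd0 X Y (t : Y -> X -> S) :
  (forall b c : X, dif (bd b) c = 0) -> (forall b c : Y, dif (bd b) c = 0) ->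
  (forall y x, dif (t y) x + dot (bd y) (fun z => t z x) = 0) ->
  forall b c : extension t, dif (bd b) c = 0.
Proof.
move=> dX dY ht [x|y] [x'|y'].
- by rewrite dif_extl (_ : dif _ _ = dif (bd x) x') // dX dot0 addr0.
- by rewrite dif_extr /dif dot0.
- by rewrite dif_extl; apply: ht.
- by rewrite dif_extr; apply: dY.
Qed.

Lemma extension_graded X Y (t : Y -> X -> S) : graded X -> graded Y ->
  (forall y x, t y x != 0 -> hdeg y = (hdeg x).+1) ->
  (forall y x, isdeg (t y x) (tdeg y) (tdeg x)) ->
  graded (extension t).
Proof.
move=> [[X1 X2] X3 X4] [[Y1 Y2] Y3 Y4] t1 t2; split; first split.
- by move=> [x|y] [x'|y'] /=; [apply: X1 | rewrite eqxx | apply: t1 | apply: Y1].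
- by move=> [x|y] [x'|y'] /=; [apply: X2 | exact: isdeg0 | apply: t2 | apply: Y2].
- by move=> [x|y] /=; [apply: X3 | apply: Y3].
- by move=> [x|y] /=; [apply: X4 | apply: Y4].
Qed.

(** Subtracting the boundary of (0, w) from a cycle kills its second component
    when that component is [dif w]; this is the effect on the boundary of the
    first component. *)
Lemma extension_correct X Y (t : Y -> X -> S) (v : X -> S) (w : Y -> S) x :
  (forall y x, dif (t y) x + dot (bd y) (fun z => t z x) = 0) ->
  dif (fun x => v x - dot w (fun y => t y x)) x
    = dif v x + dot (dif w) (fun y => t y x).
Proof.
move=> ht; rewrite {1}/dif dotB dot_dot; congr (_ + _).
rewrite dot_dot -dotNr; apply: eq_dotr => y.
by apply/eqP; rewrite eq_sym -addr_eq0 addrC; apply/eqP; apply: ht.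
Qed.

Definition bounded X r := forall b : X, (tdeg b <= hdeg b + r)%N.

(** [regle I r] bounds the regularity of S/I by r, through a resolution that
    need not be minimal. *)
Definition regle I r := exists X, [/\ graded X, resolution I X & bounded X r].

Lemma bounded_leq X r s : (r <= s)%N -> bounded X r -> bounded X s.
Proof. by move=> rs h b; apply: leq_trans (h b) _; rewrite leq_add2l. Qed.

Lemma regle_leq I r s : (r <= s)%N -> regle I r -> regle I s.
Proof. by move=> rs [X [h1 h2 h3]]; exists X; split=> //; apply: bounded_leq h3. Qed.

Section ColonSequence.
Variables (I A C : S -> Prop) (a : S).
Hypotheses (hI : hom_ideal I) (hA : hom_ideal A) (ha : isdeg a 1 0).
Hypotheses (colonP : forall p, A p <-> I (a * p)).
Hypotheses (sumP : forall p, C p <-> exists q, I (p - a * q)).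

Lemma sum_sub p : I p -> C p.
Proof. by move=> hp; apply/sumP; exists 0; rewrite mulr0 subr0. Qed.

(** A resolution of S/A, read as one of the submodule generated by [a] in S/I,
    which is isomorphic to S/A shifted by one. *)
Definition scaled (X : based_complex K m) : based_complex K m :=
  @BasedComplex K m X (@hdeg _ _ X) (fun b => (tdeg b).+1) (@bd _ _ X)
    (fun b => a * baug b).

Lemma scaled_graded X : graded X -> graded (scaled X).
Proof.
move=> [[X1 X2] X3 X4]; split; first split.
- exact: X1.
- by move=> b c u /=; rewrite addnS => /X2 ->.
- move=> b /=; have [->|nz] := eqVneq (@baug _ _ X b) 0; first by rewrite mulr0 eqxx.
  by move=> _; apply: X3.
- move=> b /=; rewrite mulrC; apply: isdegM ha => u /X4.
  by rewrite addn0 addn1 => ->.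
Qed.

Lemma eps_scaled X (v : X -> S) : @eps _ _ (scaled X) v = a * eps v.
Proof. exact: dotZr. Qed.

Lemma scaled_acyclic X : acyclic A X -> acyclic I (scaled X).
Proof.
move=> [X1 X2 X3]; split; first exact: X1.
- by move=> b; rewrite eps_scaled; apply/colonP; apply: X2.
- move=> v dv ev; apply: (X3 v dv); apply/colonP.
  by rewrite -eps_scaled.
Qed.

(** Horseshoe: 0 -> S/(I:a)(-1) -> S/I -> S/(I,a) -> 0. *)
Lemma regle_colon r s : regle A r -> regle C s -> regle I (maxn r.+1 s).
Proof.
move=> [X [gX [aX [eX heX]] bX]] [Y [gY [[Y1 Y2 Y3] [eY heY]] bY]].
have iI := hI.1; have iA := hA.1.
have aX' := scaled_acyclic aX.
(* the boundaries of Y have augmentations in C, which are multiples of a modulo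
   I: the twisting map records which multiples *)
pose g (y : Y) := - eps (bd y).
have dg w : dot w g = - eps (dif w).
  by rewrite dotNr; congr (- _); rewrite /eps /dif dot_dot.
have [||||t [t1 t2 t3 t4]] := @lift_chain_map _ _ I (scaled X) Y g hI
   (scaled_graded gX) aX' (let: And3 h _ _ := gY in h) Y1.
- move=> y; rewrite oppr_eq0; apply: contra_neq_eq => hy; apply: dot_eq0 => z.
  case: gY => [[Y4 _] Y5 _] /Y4 hz.
  apply/eqP/negP => /negP /Y5 hz0; by rewrite hz hz0 in hy.
- move=> y; apply: isdegN; apply: isdeg_sum => z _.
  by case: gY => [[_ Y4] _ Y5]; apply: isdegM (Y4 y z) (Y5 z).
- move=> y; rewrite dg /eps dot_eq0 ?oppr0; first exact: ideal0.
  by move=> z; rewrite (Y1 y z) eqxx.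
- move=> y; have /sumP[q hq] := Y2 y.
  exists (fun x => - q * eX x); rewrite eps_scaled /eps dotZ -/(eps eX) /g.
  rewrite mulNr mulrN opprK mulrA.
  rewrite (_ : _ + _ = - (eps (bd y) - a * q) - q * (a * (1 - eps eX))).
    by apply: idealB => //; [apply: idealN | apply: idealM => //; apply/colonP].
  by rewrite !mulrBr !mulr1 opprB opprB mulrCA mulrA; ring.
exists (extension t); split.
- exact: extension_graded (scaled_graded gX) gY t1 t2.
- split; first split.
  + by apply: extension_bd0 => //; case: aX'.
  + move=> [x|y]; rewrite eps_ext /=.
      rewrite (_ : eps _ = @eps _ _ (scaled X) (bd x)) //.
      rewrite [X in _ + X]dot0 addr0; by case: aX'.
    rewrite -[X in _ + X]opprK; exact: t4.
  + move=> v dv ev.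
    have dvY y : @dif _ _ Y (v \o inr) y = 0 by rewrite -dif_extr.
    have [w hw] : exists w : Y -> S, forall y, v (inr y) = dif w y.
      apply: Y3 dvY _; rewrite -[@eps _ _ Y _](addKr (@eps _ _ (scaled X) (v \o inl))).
      apply/sumP; exists (- eps (v \o inl : X -> S)).
      rewrite -eps_ext eps_scaled mulrN opprK addrC addrA subrr add0r.
      exact: ev.
    have [||u hu] := (let: And3 _ _ h := aX' in h)
        (fun x => v (inl x) - dot w (fun y => t y x)).
    * move=> x; rewrite extension_correct // -[RHS](dv (inl x)) dif_extl.
      by congr (_ + _); apply: eq_dot => y; apply: esym (hw y).
    * rewrite /eps dotB dot_dot.
      apply: (ideal_congr (q := eps v)) => //.
      rewrite eps_ext (_ : _ - _ = - dot w (fun y => eps (t y) - g y)).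
        by apply: idealN => //; apply: ideal_dot.
      have -> : @eps _ _ Y (v \o inr) = eps (dif w) by apply: eq_dot => y; apply: hw.
      by rewrite dotBr dg /eps /=; ring.
    exists (fun b => match b with inl x => u x | inr y => w y end) => -[x|y].
    * rewrite dif_extl (_ : dif _ _ = dif u x) // -hu subrK //.
    * by rewrite dif_extr hw.
  + have /sumP[q hq] := heY.
    exists (fun b => match b with inl x => q * eX x | inr y => eY y end).
    rewrite eps_ext (_ : eps _ = @eps _ _ (scaled X) (fun x => q * eX x)) //.
    rewrite eps_scaled /eps dotZ -/(eps eX) -/(eps eY).
    rewrite (_ : _ - _ = (1 - eps eY - a * q) + q * (a * (1 - eps eX))).
      by apply: idealD => //; apply: idealM => //; apply/colonP.
    by ring.
- move=> [x|y] /=.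
  + apply: leq_trans (_ : (hdeg x + r.+1 <= _)%N); first by rewrite addnS ltnS.
    by rewrite leq_add2l leq_maxl.
  + by apply: leq_trans (bY y) _; rewrite leq_add2l leq_maxr.
Qed.
(** The part of the cone that comes from the source of the map. Its generators
    have positive homological degree, hence the zero augmentation. *)
Definition suspended (X : based_complex K m) : based_complex K m :=
  @BasedComplex K m X (fun b => (hdeg b).+1) (fun b => (tdeg b).+1) (@bd _ _ X)
    (fun=> 0).

Lemma suspended_graded X : graded X -> graded (suspended X).
Proof.
move=> [[X1 X2] X3 X4]; split; first split.
- by move=> b c /= /X1 ->.
- by move=> b c u /=; rewrite addnS => /X2 ->.
- by move=> b; rewrite eqxx.
- by move=> b; exact: isdeg0.
Qed.

(** Mapping cone of multiplication by [a], for the same exact sequence. *)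
Lemma regle_sum r s : hom_ideal C -> regle A r -> regle I s -> regle C (maxn r s).
Proof.
move=> [iC _] [Y [gY rY bY]] [X [gX [aX [eX heX]] bX]].
have iI := hI.1; have iA := hA.1.
have [[Y1 Y2 Y3] _] := rY; have [X1 X2 X3] := aX.
have gY' := suspended_graded gY.
pose g (y : suspended Y) := a * @baug _ _ Y y.
have dg (w : Y -> S) : dot w g = a * eps w by rewrite dotZr.
have [||||t [t1 t2 t3 t4]] := @lift_chain_map _ _ I X (suspended Y) g hI
   gX aX (let: And3 h _ _ := gY' in h) Y1.
- move=> y; rewrite /g /=; have [->|nz] := eqVneq (@baug _ _ Y y) 0.
    by rewrite mulr0 eqxx.
  by case: gY => _ /(_ y nz) ->.
- move=> y; rewrite /g mulrC; apply: isdegM ha => u /=.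
  by case: gY => _ _ Y5 /Y5; rewrite addn0 addn1 => ->.
- by move=> y; rewrite dg; apply/colonP; apply: Y2.
- move=> y; exists (fun x => g y * eX x); rewrite /eps dotZ -/(eps eX).
  by rewrite -{1}[g y]mulr1 -mulrBr; apply: idealM.
have corr (v : X -> S) (w : Y -> S) :
    I (eps (fun x => v x - dot w (fun y => t y x)) - (eps v - a * eps w)).
  rewrite /eps dotB dot_dot -[a * dot w _]dg.
  rewrite (_ : _ - _ = - (dot w (fun y => eps (t y) - g y))).
    by apply: idealN => //; apply: ideal_dot.
  by rewrite dotBr /eps; ring.
exists (extension t); split.
- exact: extension_graded gX gY' t1 t2.
- split; first split.
  + exact: extension_bd0.
  + move=> [x|y]; rewrite eps_ext /=.
      rewrite (_ : eps _ = eps (bd x)) // [X in _ + X]dot0 addr0.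
      exact: sum_sub.
    rewrite [X in _ + X]dot0r addr0; apply/sumP; exists (@baug _ _ Y y).
    exact: t4.
  + move=> v dv ev.
    have dvY y : @dif _ _ Y (v \o inr) y = 0 by rewrite -[RHS](dv (inr y)) dif_extr.
    have dvX x : dif (v \o inl) x = - dot (v \o inr) (fun y => t y x).
      by apply/eqP; rewrite -addr_eq0 -dif_extl dv.
    have [w hw] : exists w : Y -> S, forall y, v (inr y) = dif w y.
      apply: Y3 dvY _; apply/colonP.
      rewrite -dg (_ : dot _ g = dot (v \o inr) (fun y => eps (t y))
         - dot (v \o inr) (fun y => eps (t y) - g y)); last by rewrite -dotBr;
        apply: eq_dotr => y; rewrite opprB addrC subrK.
      apply: idealB => //; last exact: ideal_dot.
      rewrite -dot_dot (eq_dot (w := fun x => - dif (v \o inl) x)); last first.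
        by move=> x; rewrite dvX opprK.
      rewrite dotN dot_dot; apply: idealN => //; apply: ideal_dot => // x _.
      exact: X2.
    (* e is concentrated in degree 0, so that multiples of e are cycles and can
       be used to change the augmentation by multiples of a *)
    have [eY heY dY] : exists2 e : Y -> S, A (1 - eps e) & forall y, dif e y = 0.
      have [e he1 he2] := unit_hvec gY rY hA.
      by exists e => // y; apply: dif_hvec0 he1; case: gY.
    have /sumP[q hq] : C (eps (fun x => v (inl x) - dot w (fun y => t y x))).
      apply: (ideal_congr (q := eps v - a * eps w)) => //.
        rewrite eps_ext [X in _ + X - _]dot0r addr0.
        exact/sum_sub/corr.
      apply: idealB => //; apply/sumP; exists (eps w); rewrite subrr.
      exact: ideal0.
    pose w' y := w y + q * eY y.
    have dw' : forall y, dif w' y = v (inr y).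
      by move=> y; rewrite {1}/dif dotD dotZ -/(dif w y) -/(dif eY y) dY mulr0 addr0 hw.
    have [||u hu] := X3 (fun x => v (inl x) - dot w' (fun y => t y x)).
    * move=> x; rewrite extension_correct // -[RHS](dv (inl x)) dif_extl.
      by congr (_ + _); apply: eq_dot => y; apply: dw'.
    * rewrite /eps (eq_dot (w := fun x => (v (inl x) - dot w (fun y => t y x))
         - dot (fun y => q * eY y) (fun y => t y x))); last first.
        by move=> x; rewrite /w' dotD opprD addrA.
      apply: (ideal_congr iI (corr _ _)).
      rewrite /eps dotZ -/(eps eY).
      rewrite (_ : _ - _ = eps (fun x => v (inl x) - dot w (fun y => t y x)) - a * q
         + q * (a * (1 - eps eY))).
        by apply: idealD => //; apply: idealM => //; apply/colonP.
      by rewrite /eps; ring.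
    exists (fun b => match b with inl x => u x | inr y => w' y end) => -[x|y].
    * rewrite dif_extl (_ : dif _ _ = dif u x) // -hu subrK //.
    * by rewrite dif_extr -dw'.
  + exists (fun b => match b with inl x => eX x | inr y => 0 end).
    rewrite eps_ext [X in _ - (_ + X)]dot0 addr0.
    exact: sum_sub.
- move=> [x|y] /=.
  + by apply: leq_trans (bX x) _; rewrite leq_add2l leq_maxr.
  + by rewrite addSn ltnS; apply: leq_trans (bY y) _; rewrite leq_add2l leq_maxl.
Qed.
End ColonSequence.
End Extensions.

(** * Minimal resolutions by cancellation *)

Section Minimization.
Variables (K : fieldType) (m : nat).
Local Notation S := {mpoly K[m]}.
Implicit Types (X : based_complex K m) (I : S -> Prop).

Definition minimal_bd X := forall b c : X, (bd b c)@_0%MM = 0.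

Section Cancellation.
Variables (I : S -> Prop) (X : based_complex K m) (k l : X).
Hypotheses (iI : is_ideal I) (gX : graded X) (rX : resolution I X).
Hypothesis ukl : (bd k l)@_0%MM != 0.

Let ci : S := ((bd k l)@_0%MM)^-1%:MP.

Lemma unit_tdeg : tdeg k = tdeg l.
Proof. by case: gX => [[_ /(_ _ _ _ ukl)]]; rewrite mdeg0. Qed.

Lemma unit_hdeg : hdeg k = (hdeg l).+1.
Proof.
case: gX => [[/(_ k l) h _] _ _]; apply: h.
by apply: contraNneq ukl => ->; rewrite mcoeff0.
Qed.

Lemma unitE : ci * bd k l = 1.
Proof.
pose c := (bd k l)@_0%MM; rewrite /ci -/c.
have -> : bd k l = c%:MP by [
  apply/mpolyP => u; rewrite mcoeffC; case: (u =P 0%MM) => [->|/eqP nz];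
  rewrite ?mulr1 // mulr0; apply/eqP; apply: contraNT nz;
  case: gX => [[_ h] _ _] /h; rewrite unit_tdeg -[RHS]add0n => /addIn;
  move/eqP; rewrite mdeg_eq0].
by rewrite -mpolyCM mulVf.
Qed.

Lemma unit_neq : k != l.
Proof. by apply/eqP => e; have := unit_hdeg; rewrite e => /n_Sn. Qed.

Definition rest_basis := {b : X | b \in [pred b | (b != k) && (b != l)]}.

(** Gaussian elimination with pivot (k, l): the entries are the Schur complement
    of the unit entry. *)
Definition cancelled : based_complex K m :=
  @BasedComplex K m rest_basis (fun b => hdeg (val b)) (fun b => tdeg (val b))
    (fun b c => bd (val b) (val c) - bd (val b) l * ci * bd k (val c))
    (fun b => baug (val b)).

Lemma dot_rest (v f : X -> S) :
  dot (fun b : cancelled => v (val b)) (fun b : cancelled => f (val b))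
    = dot v f - v k * f k - v l * f l.
Proof.
have e : \sum_(b in [pred b | (b != k) && (b != l)]) v b * f b
    = \sum_(b : cancelled) v (val b) * f (val b) := big_sub _ _.
rewrite [LHS](esym e) [in RHS]/dot [in RHS](bigD1 k) //= [in RHS](bigD1 l) /=;
  last by rewrite eq_sym unit_neq.
set t := (X in _ + (_ + X)).
change (t = v k * f k + (v l * f l + t) - v k * f k - v l * f l); ring.
Qed.

Lemma card_rest : (#|cancelled| < #|X|)%N.
Proof.
rewrite card_sig; apply: proper_card; apply/properP; split; first exact/subsetP.
by exists k => //; rewrite !inE eqxx.
Qed.

Lemma bd_ll0 (b : X) : bd b b = 0.
Proof.
apply/eqP/negP => /negP h; by case: gX => [[/(_ b b h) /n_Sn]].
Qed.

Lemma baug_k0 : baug k = 0.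
Proof.
apply/eqP/negP => /negP h; case: gX => [_ /(_ k h)]; by rewrite unit_hdeg.
Qed.

(** The effect of the cancellation on vectors: up to the terms at l, the new
    boundary is the old one corrected by a multiple of the row of k. *)
Lemma dif_rest (w : X -> S) (b : cancelled) :
  dif (fun b : cancelled => w (val b)) b
    = dif w (val b) - w l * bd l (val b) - dif w l * ci * bd k (val b).
Proof.
rewrite {1}/dif.
rewrite (dot_rest w (fun a => bd a (val b) - bd a l * ci * bd k (val b))).
rewrite dotBr (_ : dot w (fun a => bd a l * ci * bd k (val b)) =
  dif w l * ci * bd k (val b)); last first.
  by rewrite /dif /dot !mulr_suml; apply: eq_bigr => a _; rewrite !mulrA.
rewrite -/(dif w (val b)) bd_ll0 [bd k l * ci]mulrC unitE; ring.
Qed.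

Lemma eps_rest (w : X -> S) :
  eps (fun b : cancelled => w (val b)) = eps w - w l * baug l.
Proof. by rewrite /eps (dot_rest w (@baug _ _ X)) baug_k0 mulr0 subr0. Qed.

(** Subtracting a multiple of the boundary of [k] makes the coefficient at [l]
    vanish; this changes neither the boundary nor, modulo I, the augmentation. *)
Let clear (w : X -> S) b := w b - w l * ci * bd k b.

Lemma clear_l w : clear w l = 0.
Proof. by rewrite /clear -mulrA unitE mulr1 subrr. Qed.

Lemma dif_clear w b : dif (clear w) b = dif w b.
Proof.
have [[dd _ _] _] := rX.
by rewrite /clear {1}/dif dotB dotZ -/(dif (bd k) b) dd mulr0 subr0.
Qed.

Lemma eps_clear w : I (eps (clear w) - eps w).
Proof.
have [[_ da _] _] := rX.
rewrite /clear {1}/eps dotB dotZ -/(eps (bd k)) addrAC subrr add0r.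
by apply: idealN => //; apply: idealM.
Qed.

(** Cycles and boundaries are moved between the two complexes by choosing the
    coefficients at k and l so that the correction terms vanish. *)
Lemma cancelled_resolution : resolution I cancelled.
Proof.
have [[dd da ex] [e he]] := rX.
have cE a : @bd _ _ cancelled a = fun b => clear (bd (val a)) (val b) by [].
split; first split.
- move=> a b; rewrite cE dif_rest clear_l !dif_clear !dd; ring.
- move=> a; rewrite cE eps_rest clear_l mul0r subr0.
  by apply: (ideal_congr iI (eps_clear _)).
- move=> v' dv' ev'.
  (* v extends v' by 0 at l, and at k by what makes the boundary vanish at l *)
  pose v0 b := if insub b is Some b' then v' (b' : cancelled) else 0.
  have v0E (b : cancelled) : v0 (val b) = v' b by rewrite /v0 valK.
  have v0l : v0 l = 0 by rewrite /v0 insubN // !inE eqxx andbF.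
  pose v b := v0 b - dif v0 l * ci * (b == k)%:R.
  have dv1 b : dif v b = dif v0 b - dif v0 l * ci * bd k b.
    by rewrite /v {1}/dif dotB dotZ dot_delta.
  have vE (b : cancelled) : v (val b) = v' b.
    have /andP[/negbTE nk _] := valP b; by rewrite /v v0E nk mulr0 subr0.
  have vl : v l = 0 by rewrite /v v0l eq_sym (negbTE unit_neq) mulr0 subr0.
  have dvl : dif v l = 0 by rewrite dv1 -mulrA unitE mulr1 subrr.
  have dvb (b : cancelled) : dif v (val b) = 0.
    have <- : dif (fun b : cancelled => v (val b)) b = 0.
      by rewrite -[RHS](dv' b); apply: eq_dot.
    by rewrite dif_rest vl dvl; ring.
  (* the boundary of v can only be supported on k, and its own boundary at l
     is a unit multiple of that coefficient *)
  have dvk : dif v k = 0.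
    have : dif (dif v) l = 0.
      by rewrite /dif dot_dot dot_eq0 // => b _; exact: dd.
    rewrite {1}/dif /dot (bigD1 k) //= big1 ?addr0 => [h|b nb].
      by rewrite -[LHS]mulr1 -unitE mulrCA mulrA -mulrA mulrC h ?mul0r ?mulr0.
    have [->|nl] := eqVneq b l; first by rewrite dvl mul0r.
    have hb : b \in [pred b | (b != k) && (b != l)] by rewrite !inE nb.
    by have := dvb (Sub b hb); rewrite SubK => ->; rewrite mul0r.
  have [||w hw] := ex v.
  + move=> b; have [->//|nk] := eqVneq b k.
    have [->//|nl] := eqVneq b l.
    have hb : b \in [pred b | (b != k) && (b != l)] by rewrite !inE nk.
    by have := dvb (Sub b hb); rewrite SubK.
  + have := eps_rest v; rewrite vl mul0r subr0 => <-.
    by rewrite (_ : eps _ = eps v') //; apply: eq_dot.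
  exists (fun b => clear w (val b)) => b.
  by rewrite dif_rest clear_l !dif_clear -!hw vl vE; ring.
- exists (fun b => clear e (val b)).
  rewrite eps_rest clear_l mul0r subr0.
  apply: (ideal_congr (q := 1 - eps e)) => //.
  rewrite (_ : _ - _ = - (eps (clear e) - eps e)); last by ring.
  by apply: idealN => //; apply: eps_clear.
Qed.

Lemma cancelled_graded : graded cancelled.
Proof.
have [[g1 g2] g3 g4] := gX; split; first split.
- move=> a b /=; have [->|n1] := eqVneq (bd (val a) l) 0.
    by rewrite !mul0r subr0; apply: g1.
  have [->|n2] := eqVneq (bd k (val b)) 0; first by rewrite mulr0 subr0; apply: g1.
  by rewrite (g1 _ _ n1) -unit_hdeg (g1 _ _ n2).
- move=> a b /=; apply: isdegD; first exact: g2.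
  apply: isdegN; apply: isdegM (g2 _ _); rewrite unit_tdeg.
  by apply: isdegM (g2 _ _) _; apply: isdegC.
- by move=> b /=; apply: g3.
- by move=> b /=; apply: g4.
Qed.
End Cancellation.

(** A nonzero constant entry can be cancelled together with its two generators;
    as the basis shrinks, this ends with a minimal complex. *)
Lemma minimize I X : is_ideal I -> graded X -> resolution I X ->
  exists Y, [/\ graded Y, resolution I Y, minimal_bd Y &
                forall r, bounded X r -> bounded Y r].
Proof.
move=> iI; move: {2}#|X|.+1 (ltnSn #|X|) => N.
elim: N X => [//|N IH] X hN gX rX.
have [/existsP[k /existsP[l u]]|h] :=
  boolP [exists k : X, exists l : X, (bd k l)@_0%MM != 0].
  have [|Y [h1 h2 h3 h4]] := IH _ _ (cancelled_graded gX u) (cancelled_resolution iI gX rX u).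
    by apply: leq_trans (card_rest k l) _.
  exists Y; split=> // r hr; apply: h4 => b; exact: hr.
exists X; split=> // b c; apply/eqP.
by move: h; rewrite negb_exists => /forallP /(_ b); rewrite negb_exists
  => /forallP /(_ c); rewrite negbK.
Qed.

(** The regularity of S/I, read on a minimal resolution with finite basis. *)
Definition hasreg I r := exists X,
  [/\ [/\ graded X, resolution I X & minimal_bd X], bounded X r
    & exists b : X, tdeg b = (hdeg b + r)%N].

Lemma hasreg_regle I r : hasreg I r -> regle I r.
Proof. by move=> [X [[h1 h2 _] h3 _]]; exists X. Qed.

(** Some generator in homological degree 0 has a nonzero constant as
    augmentation, so the maximum of [tdeg - hdeg] is not negative. *)
Lemma regle_hasreg I r : is_ideal I -> (forall p, I p -> p@_0%MM = 0) ->
  regle I r -> exists2 s, (s <= r)%N & hasreg I s.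
Proof.
move=> iI pI [X [gX rX bX]].
have [Y [gY rY mY /(_ r bX) bY]] := minimize iI gX rX.
have [b0 hb0] : exists b : Y, tdeg b = hdeg b.
  have [_ [e he]] := rY.
  case: (pickP (fun b : Y => (baug b)@_0%MM != 0)) => [b hb|h].
    exists b; case: gY => _ g3 g4.
    rewrite -(g4 b _ hb) mdeg0 g3 //.
    by apply: contraNneq hb => ->; rewrite mcoeff0.
  have := pI _ he; rewrite mcoeffB mcoeff1 eqxx raddf_sum /= big1 ?subr0.
    by move/eqP; rewrite oner_eq0.
  move=> b _; rewrite (_ : 0%MM = (0 + 0)%MM) ?addm0 //.
  apply/eqP; apply: contraT => /mcoeffM_neq0[u [v [_ hv]]] /esym/eqP.
  by rewrite mnmD_eq0 => /andP[_ /eqP v0]; move: (h b); rewrite -v0 hv.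
pose s := \max_(b : Y) (tdeg b - hdeg b)%N.
have hs (b : Y) : (tdeg b <= hdeg b + s)%N.
  by rewrite -leq_subLR; apply: (leq_bigmax b).
exists s; first by apply/bigmax_leqP => b _; rewrite leq_subLR.
exists Y; split=> //.
have [b hb] : {b : Y | s = (tdeg b - hdeg b)%N} by apply: eq_bigmax; apply/card_gt0P; exists b0.
case: (leqP (hdeg b) (tdeg b)) => h.
  by exists b; rewrite hb subnKC.
by exists b0; rewrite hb0 hb (eqP (ltnW h)) addn0.
Qed.
End Minimization.

(** * Uniqueness of the shifts, and regularity *)

Section Comparison.
Variables (K : fieldType) (m : nat).
Local Notation S := {mpoly K[m]}.
Implicit Types (I : S -> Prop) (F G : free_sequence K m).

Definition mxdeg a b (s : 'I_a -> nat) (t : 'I_b -> nat) (M : 'M[S]_(a, b)) :=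
  forall k l, isdeg (M k l) (s k) (t l).

Definition mxhcomp a b (s : 'I_a -> nat) (t : 'I_b -> nat) (M : 'M[S]_(a, b)) :=
  \matrix_(k, l) hcomp (s k) (t l) (M k l).

Lemma mxhcomp_deg a b s t (M : 'M[S]_(a, b)) : mxdeg s t (mxhcomp s t M).
Proof. by move=> k l; rewrite mxE; apply: hcomp_isdeg. Qed.

Lemma mxhcomp_id a b s t (M : 'M[S]_(a, b)) : mxdeg s t M -> mxhcomp s t M = M.
Proof. by move=> h; apply/matrixP => k l; rewrite mxE hcomp_id. Qed.

Lemma mxhcompM a b c s t r (M : 'M[S]_(a, b)) (N : 'M[S]_(b, c)) :
  mxdeg t r N -> mxhcomp s r (M *m N) = mxhcomp s t M *m N.
Proof.
move=> hN; apply/matrixP => k l; rewrite !mxE hcomp_sum.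
by apply: eq_bigr => j _; rewrite mxE (hcompM _ _ (hN j l)).
Qed.

Lemma mxdegM a b c s t r (M : 'M[S]_(a, b)) (N : 'M[S]_(b, c)) :
  mxdeg s t M -> mxdeg t r N -> mxdeg s r (M *m N).
Proof.
move=> hM hN k l; rewrite mxE; apply: isdeg_sum => j _.
exact: isdegM (hM k j) (hN j l).
Qed.

Lemma lift_rows a b c (M : 'M[S]_(a, c)) (D : 'M[S]_(b, c)) :
  (forall k, exists w, row k M = w *m D) -> exists N, M = N *m D.
Proof.
move=> /choose_fun[w hw]; exists (\matrix_k w k).
by apply/row_matrixP => k; rewrite hw row_mul rowK.
Qed.

(** A factorization can be made graded by keeping, in each entry, the part of the
    right degree. *)
Lemma lift_graded a b c s t r (M : 'M[S]_(a, c)) (D : 'M[S]_(b, c)) :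
  mxdeg s r M -> mxdeg t r D -> (exists N, M = N *m D) ->
  exists2 N, mxdeg s t N & M = N *m D.
Proof.
move=> hM hD [N e]; exists (mxhcomp s t N); first exact: mxhcomp_deg.
by rewrite -(mxhcompM _ _ hD) -e mxhcomp_id.
Qed.

Lemma diff_deg F i : graded_maps F -> mxdeg (@shift _ _ F i.+1) (@shift _ _ F i) (diff F i).
Proof. by move=> [_ h] k l u hu; apply: h; rewrite mcoeff_msupp. Qed.

Lemma aug_deg F : graded_maps F -> forall k, isdeg (aug F k ord0) (@shift _ _ F 0 k) 0.
Proof. by move=> [h _] k u hu; rewrite addn0; apply: h; rewrite mcoeff_msupp. Qed.

Lemma diff_diff I F i : resolves I F -> diff F i.+1 *m diff F i = 0.
Proof.
move=> [_ _ h]; apply/row_matrixP => k; rewrite row_mul row0; apply/h.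
by exists (delta_mx 0 k); rewrite -rowE.
Qed.

Lemma lift_cycles I F i a (M : 'M[S]_(a, rank F i.+1)) : resolves I F ->
  M *m diff F i = 0 -> exists N, M = N *m diff F i.+1.
Proof.
move=> [_ _ h] e; apply: lift_rows => k; apply/h.
by rewrite -row_mul e row0.
Qed.

Lemma lift_cycles0 I F a (M : 'M[S]_(a, rank F 0)) : resolves I F ->
  (forall k, I ((M *m aug F) k ord0)) -> exists N, M = N *m diff F 0.
Proof.
move=> [_ h _] e; apply: lift_rows => k; apply/h.
by rewrite -row_mul mxE; apply: e.
Qed.

Section Maps.
Variables (I : S -> Prop) (F G : free_sequence K m).
Hypotheses (hI : hom_ideal I) (gF : graded_maps F) (gG : graded_maps G).
Hypotheses (rF : resolves I F) (rG : resolves I G).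

Lemma map_aug : exists phi,
  [/\ mxdeg (@shift _ _ F 0) (@shift _ _ G 0) phi,
      forall k, I ((phi *m aug G - aug F) k ord0)
    & exists N, diff F 0 *m phi = N *m diff G 0].
Proof.
have [iI hI2] := hI.
have h k : exists v : 'rV_(rank G 0), I (aug F k ord0 - (v *m aug G) ord0 ord0).
  by case: rG => h _ _; apply: h.
have [v hv] := choose_fun h.
pose phi := mxhcomp (@shift _ _ F 0) (@shift _ _ G 0) (\matrix_k v k).
have hphi k : I ((phi *m aug G - aug F) k ord0).
  have aG : mxdeg (@shift _ _ G 0) (fun _ : 'I_1 => 0%N) (aug G).
    by move=> j l; rewrite ord1; apply: aug_deg.
  rewrite /phi -(mxhcompM _ _ aG) !mxE -opprB; apply: idealN => //.
  rewrite -[X in X - _](hcomp_id (aug_deg gF (k := k))) -hcompB; apply: hI2.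
  have := hv k; congr (I (_ - _)).
  by rewrite !mxE; apply: eq_bigr => j _; rewrite mxE.
exists phi; split=> //; first exact: mxhcomp_deg.
apply: (lift_cycles0 rG) => k; rewrite -mulmxA.
apply: (ideal_congr (q := (diff F 0 *m aug F) k ord0)) => //.
  have -> : (diff F 0 *m (phi *m aug G)) k ord0 - (diff F 0 *m aug F) k ord0
     = (diff F 0 *m (phi *m aug G - aug F)) k ord0.
    by rewrite mulmxBr !mxE.
  by rewrite mxE; apply: ideal_sum => // j _; apply: idealM.
have [_ h' _] := rF.
suff -> : (diff F 0 *m aug F) k ord0 = (row k (diff F 0) *m aug F) ord0 ord0.
  by apply/h'; exists (delta_mx 0 k); rewrite -rowE.
by rewrite -row_mul !mxE.
Qed.

Lemma map_step i (phi : 'M_(rank F i, rank G i)) :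
  mxdeg (@shift _ _ F i) (@shift _ _ G i) phi ->
  (exists N, diff F i *m phi = N *m diff G i) ->
  exists phi' : 'M_(rank F i.+1, rank G i.+1),
  [/\ mxdeg (@shift _ _ F i.+1) (@shift _ _ G i.+1) phi',
      diff F i *m phi = phi' *m diff G i
    & exists N, diff F i.+1 *m phi' = N *m diff G i.+1].
Proof.
move=> dphi hN.
have [phi' h1 h2] := lift_graded (mxdegM (diff_deg (i := i) gF) dphi)
   (diff_deg (i := i) gG) hN.
exists phi'; split=> //; apply: (lift_cycles rG).
by rewrite -mulmxA -h2 mulmxA (diff_diff _ rF) mul0mx.
Qed.
End Maps.

Definition mx_const0 a b (M : 'M[S]_(a, b)) := forall k l, (M k l)@_0%MM = 0.

Lemma mcoeff0M (p q : S) : (p * q)@_0%MM = p@_0%MM * q@_0%MM.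
Proof. exact: (rmorphM (mcoeff 0%MM)). Qed.

Lemma const0_mulr a b c (M : 'M[S]_(a, b)) (N : 'M[S]_(b, c)) :
  mx_const0 N -> mx_const0 (M *m N).
Proof.
move=> h k l; rewrite mxE raddf_sum /= big1 // => j _.
by rewrite mcoeff0M h mulr0.
Qed.

Lemma const0_mull a b c (M : 'M[S]_(a, b)) (N : 'M[S]_(b, c)) :
  mx_const0 M -> mx_const0 (M *m N).
Proof.
move=> h k l; rewrite mxE raddf_sum /= big1 // => j _.
by rewrite mcoeff0M h mul0r.
Qed.

(** Maps phi and psi between the two resolutions compose to an endomorphism of
    F homotopic to the identity. Minimality makes the homotopy vanish
    modulo the variables, so that phi psi is the identity there: some entry of
    phi in the row of k is a nonzero constant, at a generator of the same degree
    as k. *)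
Lemma minimal_shift I F G i (k : 'I_(rank F i)) : hom_ideal I ->
  graded_maps F -> graded_maps G -> resolves I F -> resolves I G -> minimal F ->
  exists l : 'I_(rank G i), shift l = shift k.
Proof.
move=> hI gF gG rF rG mF; have iI := hI.1.
(* of the homotopy in degree i, only the part h that enters the next degree is
   kept, which makes a plain induction on i possible *)
suff [phi [psi [d1 _ _ _ [/(_ k k) + _]]]] : exists phi psi,
    [/\ mxdeg (@shift _ _ F i) (@shift _ _ G i) phi,
        mxdeg (@shift _ _ G i) (@shift _ _ F i) psi,
        exists N, diff F i *m phi = N *m diff G i,
        exists N, diff G i *m psi = N *m diff F i &
        mx_const0 (phi *m psi - 1%:M) /\
        exists h, diff F i *m (phi *m psi - 1%:M) = diff F i *m h *m diff F i].
  rewrite !mxE eqxx mcoeffB mcoeff1 eqxx.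
  move/subr0_eq; rewrite raddf_sum /= => e.
  have [l hl] : exists l, (phi k l)@_0%MM != 0.
    apply/existsP; apply: contraT; rewrite negb_exists => /forallP n.
    move/eqP: e; rewrite big1 1?eq_sym ?oner_eq0 // => l _.
    by rewrite mcoeff0M; move: (n l); rewrite negbK => /eqP ->; rewrite mul0r.
  by exists l; rewrite -(d1 k l _ hl) mdeg0.
elim: i {k} => [|i [phi [psi [d1 d2 l1 l2 [_ [h hh]]]]]].
  have [phi [d1 a1 l1]] := map_aug hI gF gG rF rG.
  have [psi [d2 a2 l2]] := map_aug hI gG gF rG rF.
  exists phi, psi.
  have [N hN] : exists N, phi *m psi - 1%:M = N *m diff F 0.
    apply: (lift_cycles0 rF) => k.
    rewrite mulmxBl mul1mx -mulmxA.
    rewrite (_ : _ - _ = phi *m (psi *m aug F - aug G) + (phi *m aug G - aug F)).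
      rewrite mxE; apply: idealD => //.
      by rewrite mxE; apply: ideal_sum => // j _; apply: idealM.
    by rewrite mulmxBr addrA subrK.
  split=> //; rewrite hN; split.
    by apply: const0_mulr; apply: mF.
  by exists N; rewrite mulmxA.
have [phi' [d1' e1 l1']] := map_step gF gG rF rG d1 l1.
have [psi' [d2' e2 l2']] := map_step gG gF rG rF d2 l2.
exists phi', psi'.
have [N hN] : exists N, phi' *m psi' - 1%:M - diff F i *m h = N *m diff F i.+1.
  apply: (lift_cycles rF).
  rewrite !mulmxBl mul1mx -mulmxA -e2 mulmxA -e1 -hh mulmxBr mulmx1 mulmxA.
  by rewrite subrr.
have {}hN : phi' *m psi' - 1%:M = N *m diff F i.+1 + diff F i *m h.
  by rewrite -hN subrK.
split=> //; rewrite hN; split.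
  move=> k l; rewrite mxE mcoeffD (const0_mulr _ (mF i.+1)).
  by rewrite (const0_mull _ (mF i)) addr0.
exists N; by rewrite mulmxDr !mulmxA (diff_diff _ rF) mul0mx addr0.
Qed.
End Comparison.

Section FreeSequence.
Variables (K : fieldType) (m : nat).
Local Notation S := {mpoly K[m]}.
Variables (I : S -> Prop) (X : based_complex K m).

Let part i := [pred b : X | hdeg b == i].

Definition free_sequence_of : free_sequence K m :=
  @FreeSequence K m (fun i => #|part i|) (fun i k => tdeg (enum_val k))
    (fun i => \matrix_(k, l) bd (enum_val k) (enum_val l))
    (\col_k baug (enum_val k)).

Let restrict i (w : X -> S) : 'rV[S]_#|part i| := \row_k w (enum_val k).
Let extend i (v : 'rV[S]_#|part i|) (b : X) := \sum_k v 0 k * (b == enum_val k)%:R.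

Lemma part_hdeg i (k : 'I_#|part i|) : hdeg (enum_val k) = i.
Proof. by apply/eqP; have := enum_valP k. Qed.

Lemma part_neq i (b : X) : hdeg b != i -> forall k : 'I_#|part i|, b == enum_val k = false.
Proof. by move=> h k; apply: contraNF h => /eqP ->; rewrite part_hdeg. Qed.

Lemma extendE i (v : 'rV[S]_#|part i|) k : extend v (enum_val k) = v 0 k.
Proof.
rewrite /extend (bigD1 k) //= eqxx mulr1 big1 ?addr0 // => j nj.
by rewrite (inj_eq enum_val_inj) eq_sym (negbTE nj) mulr0.
Qed.

Lemma extend_out i (v : 'rV[S]_#|part i|) b : hdeg b != i -> extend v b = 0.
Proof. by move=> h; apply: big1 => k _; rewrite part_neq // mulr0. Qed.

Lemma extend_eq i (v : 'rV[S]_#|part i|) (w : X -> S) :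
  v = restrict i w -> (forall b, hdeg b != i -> w b = 0) -> extend v =1 w.
Proof.
move=> -> hw b; case: (eqVneq (hdeg b) i) => h; last by rewrite extend_out ?hw.
have hb : b \in part i by rewrite inE h.
by rewrite -(enum_rankK_in hb hb) extendE mxE.
Qed.

Lemma dot_restrict i (w f : X -> S) : (forall b, f b != 0 -> hdeg b = i) ->
  \sum_(k < #|part i|) restrict i w 0 k * f (enum_val k) = dot w f.
Proof.
move=> hf; rewrite /dot (bigID (fun b => b \in part i)) /= [X in _ + X]big1 ?addr0.
  rewrite (big_enum_val (fun b => w b * f b)).
  by apply: eq_bigr => k _; rewrite mxE.
move=> b hb; have [->|/hf h] := eqVneq (f b) 0; first by rewrite mulr0.
by move: hb; rewrite inE h eqxx.
Qed.

Hypotheses (iI : is_ideal I) (gX : graded X) (rX : resolution I X).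

Lemma restrict_diff i w :
  restrict i.+1 w *m diff free_sequence_of i = restrict i (dif w).
Proof.
apply/rowP => l; rewrite !mxE.
under eq_bigr => k _ do rewrite [X in _ * X]mxE.
apply: (@dot_restrict i.+1 w (fun b => bd b (enum_val l))) => b hb.
by case: gX => [[h _] _ _]; rewrite (h _ _ hb) part_hdeg.
Qed.

Lemma restrict_aug w : (restrict 0 w *m aug free_sequence_of) ord0 ord0 = eps w.
Proof.
rewrite mxE; under eq_bigr => k _ do rewrite [X in _ * X]mxE.
apply: (@dot_restrict 0 w (@baug _ _ X)) => b hb.
by case: gX => _ h _; apply: h.
Qed.

Lemma diff_extend i v : v *m diff free_sequence_of i = restrict i (dif (extend v)).
Proof.
by rewrite -restrict_diff; congr (_ *m _); apply/rowP => k; rewrite mxE extendE.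
Qed.

Lemma aug_extend v : (v *m aug free_sequence_of) ord0 ord0 = eps (extend v).
Proof.
rewrite -restrict_aug; congr ((_ *m _) _ _).
by apply/rowP => k; rewrite mxE extendE.
Qed.

Lemma extend_diff i v b :
  extend (v *m diff free_sequence_of i) b = dif (extend v) b.
Proof.
apply: extend_eq; first exact: diff_extend.
move=> {}b hb; apply: dot_eq0 => c; apply: contra_neq_eq => n.
apply: extend_out; case: gX => [[h _] _ _]; by rewrite (h _ _ n).
Qed.

Lemma free_sequence_of_resolves : resolves I free_sequence_of.
Proof.
have [[dd da ex] [e he]] := rX.
have zero_out i (v : 'rV_(rank free_sequence_of i)) :
    (forall b, extend v b = 0) -> v = 0.
  by move=> h; apply/rowP => k; rewrite mxE -(extendE v).
have im i (v : 'rV_(rank free_sequence_of i)) :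
    (forall c, dif (extend v) c = 0) -> I (eps (extend v)) ->
    exists w, v = w *m diff free_sequence_of i.
  move=> h1 h2; have [w hw] := ex _ h1 h2; exists (restrict i.+1 w).
  by rewrite restrict_diff; apply/rowP => k; rewrite mxE -hw extendE.
split.
- move=> p; exists (restrict 0 (fun b => p * e b)); rewrite restrict_aug /eps dotZ.
  by rewrite -{1}[p]mulr1 -mulrBr; apply: idealM.
- move=> v; split=> [hv|[w ->]].
    apply: im; last by rewrite -aug_extend.
    move=> c; apply: dot_eq0 => b; apply: contra_neq_eq => n.
    by apply: extend_out; case: gX => [[h _] _ _]; rewrite (h _ _ n).
  rewrite aug_extend /eps (eq_dot _ (extend_diff w)) dot_dot.
  by apply: ideal_dot => // b _; apply: da.
- move=> i v; split=> [hv|[w ->]].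
    apply: im; first by move=> c; rewrite -extend_diff hv /extend big1 // => k _;
      rewrite mxE mul0r.
    rewrite /eps dot_eq0 => [|b]; first exact: ideal0.
    apply: contra_neq_eq => n; apply: extend_out.
    by case: gX => _ h _; rewrite (h _ n).
  apply: zero_out => b; rewrite extend_diff /dif (eq_dot _ (extend_diff w)) dot_dot.
  by apply: dot_eq0 => c _; apply: dd.
Qed.

Lemma free_sequence_of_minimal : minimal_bd X ->
  min_graded_free_resolution I free_sequence_of.
Proof.
move=> mX; split; last 1 first.
- by move=> i k l; rewrite mxE.
- split=> [k u|i k l u]; rewrite /= mxE mcoeff_msupp => hu.
    by case: gX => _ _ h; rewrite -(h _ _ hu) addn0.
  by case: gX => [[_ h] _ _]; apply: h.
- exact: free_sequence_of_resolves.
Qed.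
End FreeSequence.

Section Regularity.
Variables (K : fieldType) (m : nat).
Local Notation S := {mpoly K[m]}.
Implicit Types (I : S -> Prop).

(** The bases of the resolution at hand and of the chosen one have the same
    degrees, by comparing them in both directions. *)
Lemma hasreg_reg I r : hom_ideal I -> hasreg I r -> reg I = r%:Z.
Proof.
move=> hI [X [[gX rX mX] bX [b0 hb0]]]; have iI := hI.1.
have mF := free_sequence_of_minimal iI gX rX mX.
have mG : min_graded_free_resolution I (min_resolution I).
  by apply: epsilon_spec; exists (free_sequence_of X).
have bettiP i j : betti I i j != 0%N <-> exists2 b : X, hdeg b = i & tdeg b = j.
  have [g1 r1 m1] := mF; have [g2 r2 m2] := mG.
  rewrite cards_eq0; split=> [/set0Pn[k]|[b h1 h2]].
    rewrite inE => /eqP <-.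
    have [l <-] := minimal_shift k hI g2 g1 r2 r1 m2.
    by exists (enum_val l) => //; apply: part_hdeg.
  have hb : b \in [pred b : X | hdeg b == i] by rewrite inE h1.
  have [l hl] := minimal_shift (enum_rank_in hb b : 'I_(rank (free_sequence_of X) i))
    hI g1 g2 r1 r2 m1.
  by apply/set0Pn; exists l; rewrite inE hl /= enum_rankK_in // h2.
set A := fun s : int => exists i j : nat, betti I i j != 0%N /\ s = j%:Z - i%:Z.
have maxA : is_max A r.
  split.
    exists (hdeg b0), (tdeg b0); split; first by apply/bettiP; exists b0.
    by rewrite hb0 PoszD addrAC subrr add0r.
  move=> s [i [j [/bettiP[b <- <-] ->]]].
  by rewrite lerBlDr addrC -PoszD lez_nat.
have [h1 h2] : is_max A (reg I) by apply: epsilon_spec; exists r%:Z.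
by apply/eqP; rewrite Order.POrderTheory.eq_le h2 ?(maxA.2 _ h1) //; apply: maxA.1.
Qed.

Lemma hasreg_inj I r s : hom_ideal I -> hasreg I r -> hasreg I s -> r = s.
Proof.
move=> hI /(hasreg_reg hI) e /(hasreg_reg hI); rewrite e => -[].
by [].
Qed.

(** Minimizing a resolution bounded by s gives a minimal one bounded by s, and
    its regularity is r by uniqueness. *)
Lemma hasreg_min I r s : hom_ideal I -> (forall p, I p -> p@_0%MM = 0) ->
  hasreg I r -> regle I s -> (r <= s)%N.
Proof.
move=> hI pI hr /(regle_hasreg hI.1 pI)[t ts ht].
by rewrite (hasreg_inj hI hr ht).
Qed.
End Regularity.

(** * Tensor products of resolutions *)

Section Tensor.
Variables (K : fieldType) (m : nat).
Local Notation S := {mpoly K[m]}.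
Variables (X Y : based_complex K m).

(** The usual sign makes the two differentials anticommute. *)
Definition tensor_bd (p q : X * Y) : S :=
  bd p.1 q.1 * (p.2 == q.2)%:R + (-1) ^+ hdeg p.1 * (p.1 == q.1)%:R * bd p.2 q.2.

Definition tensor : based_complex K m :=
  @BasedComplex K m (X * Y)%type (fun p => hdeg p.1 + hdeg p.2)%N
    (fun p => tdeg p.1 + tdeg p.2)%N tensor_bd (fun p => baug p.1 * baug p.2).

Lemma dot_pair (v f : X * Y -> S) :
  dot v f = \sum_a dot (fun b => v (a, b)) (fun b => f (a, b)).
Proof. by rewrite /dot pair_bigA; apply: eq_bigr => -[]. Qed.

Lemma dif_tensor (v : tensor -> S) a b :
  dif v (a, b) = dif (fun x => v (x, b)) a
    + (-1) ^+ hdeg a * dif (fun y => v (a, y)) b.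
Proof.
rewrite /dif dot_pair /=.
rewrite (eq_bigr (fun x => v (x, b) * bd x a
   + (-1) ^+ hdeg x * (x == a)%:R * dot (fun y => v (x, y)) (fun y => bd y b))).
  rewrite big_split /=; congr (_ + _).
  rewrite (bigD1 a) //= eqxx mulr1 big1 ?addr0 // => x /negbTE ->.
  by rewrite mulr0 mul0r.
move=> x _; rewrite /tensor_bd dotDr /= !dotZr; congr (_ + _).
rewrite /dot (bigD1 b) //= eqxx big1 ?addr0; first by rewrite mulr1 mulrC.
by move=> y /negbTE ->; rewrite mulr0.
Qed.

Lemma eps_tensor (v : tensor -> S) :
  eps v = @eps _ _ Y (fun b => eps (fun a => v (a, b))).
Proof.
rewrite /eps dot_pair /= /dot exchange_big; apply: eq_bigr => b _ /=.
by rewrite mulr_suml; apply: eq_bigr => a _; rewrite mulrA.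
Qed.

Lemma tensor_graded : graded X -> graded Y -> graded tensor.
Proof.
move=> [[X1 X2] X3 X4] [[Y1 Y2] Y3 Y4]; split; first split.
- move=> [a b] [a' b'] /=; rewrite /tensor_bd /=.
  have [->|/X1 ha] := eqVneq (bd a a') 0.
    rewrite mul0r add0r; case: (eqVneq a a') => [<-|_]; last first.
      by rewrite mulr0 mul0r eqxx.
    have [->|/Y1 hb] := eqVneq (bd b b') 0; first by rewrite mulr0 eqxx.
    by rewrite hb addnS.
  case: (eqVneq b b') => [<- _|_]; first by rewrite ha addSn.
  rewrite mulr0 add0r; case: (eqVneq a a') ha => [<- /n_Sn //|_ _].
  by rewrite mulr0 mul0r eqxx.
- move=> [a b] [a' b'] /=; rewrite /tensor_bd /=; apply: isdegD.
    case: (eqVneq b b') => [<-|_]; last by rewrite mulr0; apply: isdeg0.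
    by rewrite mulr1; apply: isdeg_shift; apply: X2.
  case: (eqVneq a a') => [<-|_]; last by rewrite mulr0 mul0r; apply: isdeg0.
  rewrite mulr1 -signr_odd mulr_sign.
  have h : isdeg (bd b b') (tdeg a + tdeg b) (tdeg a + tdeg b').
    by rewrite ![(tdeg a + _)%N]addnC; apply: isdeg_shift; apply: Y2.
  by case: odd => //; apply: isdegN.
- move=> [a b] /=; have [->|/X3 ->] := eqVneq (baug a) 0.
    by rewrite mul0r eqxx.
  have [->|/Y3 -> //] := eqVneq (baug b) 0; by rewrite mulr0 eqxx.
- move=> [a b] /=; apply: isdegM (Y4 b).
  by move=> u /X4 <-; rewrite addn0.
Qed.

Lemma tensor_minimal : minimal_bd X -> minimal_bd Y -> minimal_bd tensor.
Proof.
move=> mX mY [a b] [a' b']; rewrite /= /tensor_bd mcoeffD !mcoeff0M /=.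
by rewrite mX mY mul0r mulr0 addr0.
Qed.

(** The hypothesis [exY] says that Y stays exact after tensoring with S/I, that
    is, Tor(S/I, S/J) = 0 in positive degrees. *)
Section Exactness.
Variables I J L : S -> Prop.
Hypotheses (iI : is_ideal I) (iL : is_ideal L).
Hypotheses (IL : forall p, I p -> L p) (JL : forall p, J p -> L p).
Hypotheses (gX : graded X) (rX : resolution I X).
Hypotheses (ddY : forall b c : Y, dif (bd b) c = 0)
  (daY : forall b : Y, J (eps (bd b))) (surY : exists e : Y -> S, J (1 - eps e)).
Hypothesis exY : forall y : Y -> S, (forall b, I (dif y b)) -> L (eps y) ->
  exists u : Y -> S, forall b, I (y b - dif u b).

Lemma tensor_dd (p q : tensor) : dif (bd p) q = 0.
Proof.
have [[ddX _ _] _] := rX; case: p q => [a b] [a' b']; rewrite dif_tensor /= /tensor_bd /=.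
have -> : dif (fun x => bd a x * (b == b')%:R + (-1) ^+ hdeg a * (a == x)%:R * bd b b') a'
    = (-1) ^+ hdeg a * bd b b' * bd a a'.
  rewrite /dif (eq_dot (w := fun x => (b == b')%:R * bd a x
    + (-1) ^+ hdeg a * bd b b' * (x == a)%:R)); last first.
    by move=> x; rewrite mulrC [a == x]eq_sym; congr (_ + _); rewrite mulrAC.
  by rewrite dotD !dotZ dot_delta -/(dif (bd a) a') ddX mulr0 add0r.
have -> : dif (fun y => bd a a' * (b == y)%:R + (-1) ^+ hdeg a * (a == a')%:R * bd b y) b'
    = bd a a' * bd b b'.
  rewrite /dif (eq_dot (w := fun y => bd a a' * (y == b)%:R
    + (-1) ^+ hdeg a * (a == a')%:R * bd b y)); last first.
    by move=> y; rewrite [b == y]eq_sym.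
  by rewrite dotD !dotZ dot_delta -/(dif (bd b) b') ddY mulr0 addr0.
have [->|h] := eqVneq (bd a a') 0.
  by rewrite mul0r !mulr0 addr0.
case: gX => [[/(_ _ _ h) -> _] _ _]; rewrite exprS; ring.
Qed.

Lemma tensor_da (p : tensor) : L (eps (bd p)).
Proof.
have [[_ daX _] _] := rX; case: p => [a b]; rewrite eps_tensor.
rewrite (_ : eps _ = eps (bd a) * baug b + (-1) ^+ hdeg a * baug a * eps (bd b)).
  by apply: idealD => //; [rewrite mulrC; apply: idealM => //; apply: IL
                          | apply: idealM => //; apply: JL].
rewrite {1}/eps (eq_dot (w := fun y => eps (bd a) * (y == b)%:R
  + (-1) ^+ hdeg a * baug a * bd b y)).
  by rewrite dotD !dotZ dot_delta.
move=> y; rewrite /= /tensor_bd /= {1}/eps dotD; congr (_ + _).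
  rewrite (eq_dot (w := fun x => (y == b)%:R * bd a x)) ?dotZ 1?mulrC //.
  by move=> x; rewrite mulrC eq_sym.
rewrite (eq_dot (w := fun x => (-1) ^+ hdeg a * bd b y * (x == a)%:R)).
  by rewrite dotZ dot_delta mulrAC.
by move=> x; rewrite mulrAC eq_sym.
Qed.

(** A cycle living over homological degrees at least k of the first factor
    bounds: its component in degree k is columnwise a cycle of X, and lifting
    it pushes the cycle to degrees at least k + 1. *)
Lemma tensor_exact_above k (z : tensor -> S) :
  (forall a b, (hdeg a < k)%N -> z (a, b) = 0) -> (forall p, dif z p = 0) ->
  (forall b, I (eps (fun a => z (a, b)))) -> exists w, forall p, z p = dif w p.
Proof.
have [[ddX daX exX] _] := rX; have [[X1 _] X3 _] := gX.
(* descending induction on k: nothing lives above the top degree *)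
set N := (\max_(a : X) hdeg a).+1; have := leq_addr k N.
elim: {2}N k z => [|n IH] k z hn z0 dz ez.
  exists (fun=> 0) => -[a b]; rewrite [RHS]dot0; apply: z0.
  by apply: leq_trans hn; rewrite /N ltnS; apply: (leq_bigmax a).
pose zk b a := if hdeg a == k then z (a, b) else 0.
have hzk b : exists w : X -> S, forall a, zk b a = dif w a.
  apply: exX => [c|].
    have [hc|hc] := eqVneq (hdeg c).+1 k.
      rewrite (_ : dif _ _ = dif (fun a => z (a, b)) c).
        have := dz (c, b); rewrite dif_tensor.
        rewrite [X in _ + _ * X](_ : _ = 0) ?mulr0 ?addr0 //.
        by apply: dot_eq0 => y; rewrite z0 ?eqxx // -hc.
      rewrite /dif /dot; apply: eq_bigr => a _; rewrite /zk.
      have [->|/X1 ->] := eqVneq (bd a c) 0; first by rewrite !mulr0.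
      by rewrite hc eqxx.
    apply: dot_eq0 => a; rewrite /zk; case: (hdeg a =P k) => [ha _|]; last by rewrite eqxx.
    by apply: contraNeq hc => /X1 <-; rewrite ha.
  case: k z0 hn @zk => [|k] z0 hn zk.
    rewrite (_ : eps _ = eps (fun a => z (a, b))) //.
    rewrite /eps /dot; apply: eq_bigr => a _; rewrite /zk.
    have [->|/X3 ->] := eqVneq (baug a) 0; first by rewrite !mulr0.
    by rewrite eqxx.
  rewrite /eps dot_eq0; first exact: ideal0.
  move=> a; rewrite /zk; case: (hdeg a =P k.+1) => [ha _|]; last by rewrite eqxx.
  by apply/eqP/negP => /negP /X3; rewrite ha.
have [w0 hw0] := choose_fun hzk.
pose w (p : tensor) := if hdeg p.1 == k.+1 then w0 p.2 p.1 else 0.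
have dwX a b : dif (fun x => w (x, b)) a = zk b a.
  rewrite /zk; case: (hdeg a =P k) => ha.
    have := hw0 b a; rewrite /zk ha eqxx => ->.
    rewrite /dif /dot; apply: eq_bigr => x _; rewrite /w /=.
    have [->|/X1 ->] := eqVneq (bd x a) 0; first by rewrite !mulr0.
    by rewrite ha eqxx.
  apply: dot_eq0 => x; rewrite /w /=; case: (hdeg x =P k.+1) => [hx _|]; last by rewrite eqxx.
  by apply/eqP/negP => /negP /X1; rewrite hx => -[] /esym.
have wY a b : hdeg a != k.+1 -> dif (fun y => w (a, y)) b = 0.
  by move=> h; apply: dot_eq0 => y; rewrite /w /= (negbTE h) eqxx.
have [||||w' hw'] := IH k.+1 (fun p => z p - dif w p).
- by rewrite -addSnnS.
- move=> a b; rewrite ltnS => ha; rewrite dif_tensor dwX wY ?mulr0 ?addr0.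
    rewrite /zk; case: (hdeg a =P k) => hk; first by rewrite subrr.
    by rewrite subr0 z0 // ltn_neqAle ha andbT; apply/eqP.
  by rewrite neq_ltn ltnS ha.
- move=> p; rewrite {1}/dif dotB dot_dot -/(dif z p) dz.
  by rewrite dot_eq0 ?subr0 // => q _; apply: tensor_dd.
- move=> b; rewrite /eps dotB; apply: idealB => //.
    exact: ez.
  rewrite (_ : dot _ _ = eps (fun a => dif (fun x => w (x, b)) a)); last first.
    rewrite /eps /dot; apply: eq_bigr => a _; rewrite dif_tensor.
    have [->|/X3 h] := eqVneq (baug a) 0; first by rewrite !mulr0.
    by rewrite wY ?h // mulr0 addr0.
  rewrite /eps dot_dot; apply: ideal_dot => // a _; exact: daX.
exists (fun p => w p + w' p) => p.
by rewrite /dif dotD -/(dif w p) -/(dif w' p) -hw' addrC subrK.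
Qed.

(** The augmentations of the columns of a cycle form a cycle of Y modulo I, hence
    a boundary modulo I; correcting by it leaves columns whose augmentations
    are in I, to which the previous lemma applies with k = 0. *)
Lemma tensor_resolution : resolution L tensor.
Proof.
have [[ddX daX exX] [e he]] := rX; have [[X1 _] X3 _] := gX.
split; first split.
- exact: tensor_dd.
- exact: tensor_da.
- move=> z dz ez.
  have [||u hu] := exY (y := fun b => eps (fun a => z (a, b))).
  + move=> b; rewrite /dif /eps.
    have -> : dot (fun y => dot (fun a => z (a, y)) (@baug _ _ X)) (fun y => bd y b)
            = dot (fun a => dif (fun y => z (a, y)) b) (@baug _ _ X).
      rewrite /dot; under eq_bigr do rewrite mulr_suml.
      rewrite exchange_big; apply: eq_bigr => a _ /=; rewrite mulr_suml.
      by apply: eq_bigr => y _; rewrite mulrAC.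
    have -> : dot (fun a => dif (fun y => z (a, y)) b) (@baug _ _ X)
            = - dot (dif (fun x => z (x, b))) (@baug _ _ X).
      rewrite -dotN /dot; apply: eq_bigr => a _.
      have [->|/X3 h] := eqVneq (baug a) 0; first by rewrite !mulr0.
      have /eqP := dz (a, b); rewrite dif_tensor h expr0 mul1r addrC addr_eq0.
      by move/eqP => ->.
    by rewrite dot_dot; apply: idealN => //; apply: ideal_dot => // a _; apply: daX.
  + by rewrite -eps_tensor.
  pose u' (p : tensor) := e p.1 * u p.2.
  have du' a b : dif u' (a, b) = u b * dif e a + (-1) ^+ hdeg a * (e a * dif u b).
    rewrite dif_tensor /u' /=; congr (_ + _ * _); last by rewrite /dif dotZ.
    by rewrite /dif -dotZ; apply: eq_dot => x; rewrite mulrC.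
  have [|||w hw] := @tensor_exact_above 0 (fun p => z p - dif u' p).
  + by [].
  + move=> p; rewrite {1}/dif dotB dot_dot -/(dif z p) dz.
    by rewrite dot_eq0 ?subr0 // => q _; apply: tensor_dd.
  + move=> b; rewrite /eps dotB.
    have -> : dot (fun a => dif u' (a, b)) (@baug _ _ X)
            = u b * dot (dif e) (@baug _ _ X) + dif u b * eps e.
      rewrite -[dif u b * _]dotZ -dotZ -dotD /dot; apply: eq_bigr => a _.
      rewrite du'; have [->|/X3 ->] := eqVneq (baug a) 0; first by rewrite !mulr0.
      by rewrite expr0 mul1r [e a * _]mulrC.
    rewrite (_ : _ - _ = (eps (fun a => z (a, b)) - dif u b)
      + dif u b * (1 - eps e) - u b * dot (dif e) (@baug _ _ X)).
      apply: idealB => //; first by apply: idealD => //; apply: idealM.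
      by apply: idealM => //; rewrite dot_dot; apply: ideal_dot => // a _; apply: daX.
    rewrite /eps; ring.
  exists (fun p => w p + u' p) => p.
  by rewrite /dif dotD -/(dif w p) -/(dif u' p) -hw subrK.
- have [eY heY] := surY; exists (fun p => e p.1 * eY p.2).
  rewrite eps_tensor /eps /=.
  rewrite (eq_dot (w := fun b => eps e * eY b)); last first.
    by move=> b; rewrite mulrC -dotZ; apply: eq_dot => a; rewrite mulrC.
  rewrite dotZ -/(eps eY) (_ : _ - _ = (1 - eps e) + eps e * (1 - eps eY)); last by ring.
  by apply: idealD => //; [apply: IL | apply: idealM => //; apply: JL].
Qed.
End Exactness.
End Tensor.

(** * Change of the set of variables *)

Lemma mpoly_morph_eq (R : nzRingType) n (T : nzRingType)
  (f g : {rmorphism {mpoly R[n]} -> T}) :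
  (forall c, f c%:MP = g c%:MP) -> (forall i, f 'X_i = g 'X_i) -> f =1 g.
Proof.
move=> hC hX p; rewrite [p]mpolyE !rmorph_sum; apply: eq_bigr => u _ /=.
rewrite -mul_mpolyC !rmorphM hC mpolyXE_id !rmorph_prod; congr (_ * _).
by apply: eq_bigr => i _; rewrite !rmorphXn hX.
Qed.

Lemma additive_neq0 (R : nzRingType) n (V : zmodType)
  (f : {additive {mpoly R[n]} -> V}) p :
  f p != 0 -> exists2 v, p@_v != 0 & f (p@_v *: 'X_[v]) != 0.
Proof.
move=> h; have /hasP[v hv hu] : has (fun v => f (p@_v *: 'X_[v]) != 0) (msupp p).
  apply: contraNT h => /hasPn h; rewrite [p]mpolyE raddf_sum big_seq big1 // => v /h.
  by rewrite negbK => /eqP.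
by exists v; rewrite // -mcoeff_msupp.
Qed.

Section BaseChange.
Variables (K : fieldType) (m n : nat) (iota : 'I_n -> 'I_m).
Hypothesis iota_inj : injective iota.
Local Notation S := {mpoly K[m]}.
Local Notation R := {mpoly K[n]}.

Definition preimage (i : 'I_m) : option 'I_n := [pick j | iota j == i].

Lemma preimageK j : preimage (iota j) = Some j.
Proof.
rewrite /preimage; case: pickP => [j' /eqP/iota_inj -> //|/(_ j)].
by rewrite eqxx.
Qed.

(** A monomial of S is the product of a monomial in the variables outside the
    image of [iota] and of one in the variables of the image. *)
Definition outer (u : 'X_{1..m}) : 'X_{1..m} :=
  [multinom (if preimage i is Some _ then 0 else u i)%N | i < m].
Definition inner (u : 'X_{1..m}) : 'X_{1..n} := [multinom u (iota j) | j < n].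
Definition emb (v : 'X_{1..n}) : 'X_{1..m} :=
  [multinom (if preimage i is Some j then v j else 0)%N | i < m].

Lemma embK v : inner (emb v) = v.
Proof. by apply/mnmP => j; rewrite !mnmE preimageK. Qed.

Lemma outer_inner u : u = (outer u + emb (inner u))%MM.
Proof.
apply/mnmP => i; rewrite mnmDE !mnmE; case E: (preimage i) => [j|].
  by rewrite mnmE add0n; move: E; rewrite /preimage; case: pickP => // k /eqP <- [->].
by rewrite addn0.
Qed.

Definition extend_scalars : R -> S := mmap (@mpolyC m K) (fun j => 'X_(iota j)).
HB.instance Definition _ := GRing.RMorphism.on extend_scalars.

Lemma extend_scalarsC c : extend_scalars c%:MP = c%:MP.
Proof. exact: mmapC. Qed.

Lemma extend_scalarsX v : extend_scalars 'X_[v] = 'X_[emb v].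
Proof.
rewrite /extend_scalars mmapX /mmap1 [RHS]mpolyXE_id.
rewrite (bigID (fun i => preimage i)) /= [X in _ = _ * X]big1 ?mulr1; last first.
  by move=> i; rewrite mnmE; case: preimage => // _; rewrite expr0.
rewrite (reindex_omap iota preimage) /=.
  by apply: eq_big => j; rewrite ?mnmE preimageK ?eqxx.
by move=> i; rewrite /preimage; case: pickP => //= j /eqP ->.
Qed.

Lemma mcoeff_extend_scalars p u : (extend_scalars p)@_u != 0 ->
  exists2 v, p@_v != 0 & u = emb v.
Proof.
move=> /(additive_neq0 (f := mcoeff u \o extend_scalars))[v hv /= hu].
exists v => //; apply/eqP.
rewrite -mul_mpolyC rmorphM /= extend_scalarsC extend_scalarsX mcoeffCM mcoeffX in hu.
by apply: contraNT hu; rewrite eq_sym => /negbTE ->; rewrite mulr0.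
Qed.

Lemma mdeg_emb v : mdeg (emb v) = mdeg v.
Proof.
rewrite !mdegE (bigID (fun i => preimage i)) /= [X in (_ + X)%N]big1 ?addn0; last first.
  by move=> i; rewrite mnmE; case: preimage.
rewrite (reindex_omap iota preimage) /=.
  by apply: eq_big => j; rewrite ?mnmE preimageK ?eqxx.
by move=> i; rewrite /preimage; case: pickP => //= j /eqP ->.
Qed.

Lemma extend_scalars_deg p s t : isdeg p s t -> isdeg (extend_scalars p) s t.
Proof. by move=> hp u /mcoeff_extend_scalars[v hv ->]; rewrite mdeg_emb; apply: hp. Qed.

Lemma extend_scalars_const p : (extend_scalars p)@_0%MM = p@_0%MM.
Proof.
apply: (mpoly_morph_eq (f := mcoeff 0%MM \o extend_scalars) (g := mcoeff 0%MM)).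
  by move=> c /=; rewrite extend_scalarsC !mcoeffC !eqxx.
move=> i /=; rewrite extend_scalarsX !mcoeffX; congr (nat_of_bool _)%:R.
by rewrite -!mdeg_eq0 mdeg_emb.
Qed.

(** S as a polynomial ring over R, in the variables outside the image. The ring
    still has m variables: those of the image do not occur in the values. *)
Definition relative : S -> {mpoly R[m]} :=
  mmap (@mpolyC m R \o @mpolyC n K)
    (fun i => if preimage i is Some j then ('X_j)%:MP else 'X_i).
HB.instance Definition _ := GRing.RMorphism.on relative.

Lemma relative_extend p : relative (extend_scalars p) = p%:MP.
Proof.
apply: (mpoly_morph_eq (f := relative \o extend_scalars) (g := @mpolyC m R)).
  by move=> c /=; rewrite extend_scalarsC [LHS]mmapC.
by move=> j /=; rewrite /extend_scalars mmapX mmap1U [LHS]mmapX mmap1U preimageK.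
Qed.

Lemma relativeX u : relative 'X_[u] = 'X_[inner u] *: 'X_[outer u].
Proof.
rewrite {1}(outer_inner u) mpolyXD -extend_scalarsX rmorphM /= relative_extend.
rewrite mulrC mul_mpolyC; congr (_ *: _).
rewrite [LHS]mmapX /mmap1 [RHS]mpolyXE_id; apply: eq_bigr => i _.
by rewrite mnmE; case: preimage => [j|//]; rewrite !expr0.
Qed.

(** Stated as a mere necessary condition on the support, which is what membership
    in a monomial ideal requires. *)
Lemma mcoeff_relative p a b : (relative p)@_a@_b != 0 ->
  exists u, [/\ p@_u != 0, outer u = a & inner u = b].
Proof.
move=> /(additive_neq0 (f := mcoeff b \o mcoeff a \o relative))[u hp /=].
rewrite -mul_mpolyC rmorphM /= relativeX [relative _]mmapC mcoeffCM mcoeffZ mcoeffX /=.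
case: (outer u =P a) => [ea|]; last by rewrite !mulr0 mcoeff0 eqxx.
rewrite mulr1 mcoeffCM mcoeffX; case: (inner u =P b) => [eb|]; last by rewrite mulr0 eqxx.
by exists u.
Qed.

Definition absolute : {mpoly R[m]} -> S := mmap extend_scalars (fun i => 'X_i).
HB.instance Definition _ := GRing.RMorphism.on absolute.

Lemma absoluteK p : absolute (relative p) = p.
Proof.
apply: (mpoly_morph_eq (f := absolute \o relative) (g := idfun)) => [c|i] /=.
  rewrite [relative _]mmapC /= [LHS]mmapC; exact: extend_scalarsC.
rewrite [relative _]mmapX mmap1U; case E: (preimage i) => [j|].
  rewrite [LHS]mmapC [LHS]mmapX mmap1U.
  by move: E; rewrite /preimage; case: pickP => // k /eqP <- [->].
by rewrite [LHS]mmapX mmap1U.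
Qed.

Lemma relative_expand p k : (msize (relative p) <= k)%N ->
  p = \sum_(a : 'X_{1..m < k}) extend_scalars (relative p)@_a * 'X_[a].
Proof.
move=> hk; rewrite -{1}[p]absoluteK /absolute (mmapE k) //.
by apply: eq_bigr => a _; rewrite mmap1_id.
Qed.

Definition base_change (B : based_complex K n) : based_complex K m :=
  @BasedComplex K m B (@hdeg _ _ B) (@tdeg _ _ B)
    (fun b c => extend_scalars (bd b c)) (fun b => extend_scalars (baug b)).

Lemma base_change_graded B : graded B -> graded (base_change B).
Proof.
move=> [[g1 g2] g3 g4]; split; first split.
- move=> b c /=; have [->|/g1 //] := eqVneq (@bd _ _ B b c) 0.
  by rewrite rmorph0 eqxx.
- by move=> b c; apply: extend_scalars_deg; apply: g2.
- move=> b /=; have [->|/g3 //] := eqVneq (@baug _ _ B b) 0.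
  by rewrite rmorph0 eqxx.
- by move=> b; apply: extend_scalars_deg; apply: g4.
Qed.

Lemma base_change_minimal B : minimal_bd B -> minimal_bd (base_change B).
Proof. by move=> h b c /=; rewrite extend_scalars_const. Qed.

Lemma dot_extend_scalars (T : finType) (v f : T -> R) :
  extend_scalars (dot v f) = dot (extend_scalars \o v) (extend_scalars \o f).
Proof. by rewrite rmorph_sum; apply: eq_bigr => b _; rewrite rmorphM. Qed.

Lemma relative_dot (T : finType) (v : T -> S) (f : T -> R) a :
  (relative (dot v (extend_scalars \o f)))@_a = dot (fun b => (relative (v b))@_a) f.
Proof.
rewrite rmorph_sum raddf_sum; apply: eq_bigr => b _.
by rewrite rmorphM /= relative_extend mulrC mcoeffCM mulrC.
Qed.

Section Flatness.
Variables (Q : pred 'X_{1..m}) (Q' : pred 'X_{1..n}) (B : based_complex K n).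
Hypotheses (hQ : upset Q) (hQ' : upset Q').
Hypothesis Q_outer : forall u, Q u -> Q (outer u).
Hypothesis rB : resolution (mideal Q') B.

Let Qe := [pred u | Q u || Q' (inner u)].

Lemma inner_upset : upset [pred u | Q' (inner u)].
Proof.
move=> u v /=; have -> : inner (u + v)%MM = (inner u + inner v)%MM; last exact: hQ'.
by apply/mnmP => j; rewrite !mnmE.
Qed.

Lemma sum_upset : upset Qe.
Proof.
move=> u v /orP[h|h]; apply/orP; [left; exact: hQ | right; exact: inner_upset].
Qed.

Lemma mideal_extend p : mideal Q' p -> mideal [pred u | Q' (inner u)] (extend_scalars p).
Proof. by move=> hp u /mcoeff_extend_scalars[v /hp hv ->]; rewrite /= embK. Qed.

(** S/(Q) is a free R-module, with basis the monomials in the outer variables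
    that do not satisfy [Q]. Hence B stays exact after tensoring with it. *)
Lemma base_change_exact (y : base_change B -> S) :
  (forall b, mideal Q (dif y b)) -> mideal Qe (eps y) ->
  exists u : base_change B -> S, forall b, mideal Q (y b - dif u b).
Proof.
move=> dy ey; have [[_ _ ex] _] := rB.
pose c a (b : B) := (relative (y b))@_a.
have hw a : exists w : B -> R, ~~ Q a -> forall b, c a b = dif w b.
  case: (boolP (Q a)) => [_|nQ]; first by exists (fun=> 0).
  have [||w hw] := ex (c a).
  - move=> b; rewrite /dif -(relative_dot (y : B -> S)).
    apply/mpolyP => v; rewrite mcoeff0; apply/eqP; apply: contraNT nQ.
    move=> /mcoeff_relative[u [hu <- _]]; apply: Q_outer; exact: dy hu.
  - rewrite /eps -(relative_dot (y : B -> S)) => v.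
    move=> /mcoeff_relative[u [hu ea <-]].
    have /orP[/Q_outer|//] := ey u hu; by rewrite ea (negbTE nQ).
  by exists w.
(* k bounds the degrees of the outer monomials that occur, so that they range
   over a finite type *)
have [w {}hw] := choose_fun hw.
pose k := \max_(b : B) msize (relative (y b)).
have yE b : y b = \sum_(a : 'X_{1..m < k}) extend_scalars (c a b) * 'X_[a].
  by apply: relative_expand; apply: (leq_bigmax b).
exists (fun b => \sum_(a : 'X_{1..m < k} | ~~ Q a) extend_scalars (w a b) * 'X_[a]) => b.
have iQ := mideal_ideal K hQ.
rewrite (_ : dif _ b = \sum_(a : 'X_{1..m < k} | ~~ Q a) extend_scalars (c a b) * 'X_[a]).
  rewrite yE (bigID (fun a : 'X_{1..m < k} => Q a)) /= addrK.
  by apply: (@ideal_sum _ _ _ _ _ _ iQ) => a qa; apply: (@idealM _ _ _ _ iQ); apply: midealX.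
rewrite /dif /dot; under eq_bigr do rewrite mulr_suml.
rewrite exchange_big; apply: eq_bigr => a nQ /=.
rewrite hw // dot_extend_scalars mulr_suml; apply: eq_bigr => b' _ /=.
by rewrite mulrAC.
Qed.

Lemma tensor_base_change (X : based_complex K m) :
  graded X -> resolution (mideal Q) X ->
  resolution (mideal Qe) (tensor X (base_change B)).
Proof.
move=> gX rX; have [[dd da ex] [e he]] := rB.
apply: (@tensor_resolution K m X (base_change B) (mideal Q)
  (mideal [pred u | Q' (inner u)])) => //.
- exact: mideal_ideal.
- exact/mideal_ideal/sum_upset.
- by move=> p; apply: mideal_sub => u hu; rewrite /Qe /= hu.
- by move=> p; apply: mideal_sub => u hu; apply/orP; right.
- move=> b b'; rewrite /dif.
  rewrite -(dot_extend_scalars (@bd _ _ B b) (fun c => @bd _ _ B c b')).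
  by rewrite [dot _ _](dd b b') rmorph0.
- move=> b; rewrite /eps -(dot_extend_scalars (@bd _ _ B b) (@baug _ _ B)).
  by apply: mideal_extend; apply: da.
- exists (extend_scalars \o e); rewrite /eps -(dot_extend_scalars e (@baug _ _ B)).
  rewrite -(rmorph1 extend_scalars) -rmorphB; exact: mideal_extend.
- exact: base_change_exact.
Qed.
End Flatness.

(** Regularity is additive for ideals in disjoint sets of variables: the tensor
    product of minimal resolutions is minimal. *)
Lemma hasreg_tensor (Q : pred 'X_{1..m}) (Q' : pred 'X_{1..n}) r s :
  upset Q -> upset Q' -> (forall u, Q u -> Q (outer u)) ->
  hasreg (@mideal K m Q) r -> hasreg (@mideal K n Q') s ->
  hasreg (@mideal K m [pred u | Q u || Q' (inner u)]) (r + s).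
Proof.
move=> hQ hQ' Qo [X [[gX rX mX] bX [a ha]]] [B [[gB rB mB] bB [b hb]]].
exists (tensor X (base_change B)); split; first split.
- by apply: tensor_graded => //; apply: base_change_graded.
- exact: tensor_base_change.
- by apply: tensor_minimal => //; apply: base_change_minimal.
- by move=> [x y] /=; rewrite addnACA; apply: leq_add; [apply: bX | apply: bB].
- by exists (a, b); rewrite /= ha hb addnACA.
Qed.
End BaseChange.

(** * Ideals generated by variables and edges *)

Section Existence.
Variables (K : fieldType) (m : nat).
Local Notation S := {mpoly K[m]}.
Implicit Types (Q : pred 'X_{1..m}) (V : {set 'I_m}) (e : rel 'I_m) (u : 'X_{1..m}).

Lemma eq_mideal Q1 Q2 (p : S) : Q1 =1 Q2 -> mideal Q1 p <-> mideal Q2 p.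
Proof. by move=> h; split; apply: mideal_sub => u; rewrite h. Qed.

Lemma eq_resolution (I J : S -> Prop) (X : based_complex K m) :
  (forall p, I p <-> J p) -> resolution I X -> resolution J X.
Proof.
move=> h [[h1 h2 h3] [w hw]]; split; first split=> //.
- by move=> b; apply/h.
- by move=> v dv /h ev; apply: h3.
- by exists w; apply/h.
Qed.

Lemma eq_regle Q1 Q2 r : Q1 =1 Q2 -> regle (@mideal K m Q1) r -> regle (@mideal K m Q2) r.
Proof.
move=> h [X [h1 h2 h3]]; exists X; split=> //; apply: eq_resolution h2 => p.
exact: eq_mideal.
Qed.

Lemma eq_hasreg Q1 Q2 r : Q1 =1 Q2 -> hasreg (@mideal K m Q1) r -> hasreg (@mideal K m Q2) r.
Proof.
move=> h [X [[h1 h2 h3] h4 h5]]; exists X; split=> //; split=> //.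
by apply: eq_resolution h2 => p; apply: eq_mideal.
Qed.

Lemma mideal_const0 Q (p : S) : ~~ Q 0%MM -> mideal Q p -> p@_0%MM = 0.
Proof. by move=> nQ hp; apply/eqP; apply: contraNT nQ => /hp. Qed.

Section Variable_step.
Variables (Q Qc Qs : pred 'X_{1..m}) (i : 'I_m).
Hypotheses (hQ : upset Q) (hQc : upset Qc) (hQs : upset Qs).
Hypotheses (colonE : forall u, Qc u = Q (U_(i) + u)%MM)
  (sumE : forall u, Qs u = Q u || (u i != 0%N)).

Let colonP (p : S) : mideal Qc p <-> mideal Q ('X_i * p).
Proof. by rewrite midealMX; apply: eq_mideal. Qed.

Let sumP (p : S) : mideal Qs p <-> exists q, mideal Q (p - 'X_i * q).
Proof. by rewrite -midealD_var; apply: eq_mideal => u; rewrite sumE -lep1mP. Qed.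

Let degX : isdeg ('X_i : S) 1 0.
Proof. by apply: isdegX; rewrite mdeg1. Qed.

(** For monomial ideals, the colon by a variable and the sum with it are read on
    monomials. *)
Lemma regle_var_colon r s : regle (@mideal K m Qc) r -> regle (@mideal K m Qs) s ->
  regle (@mideal K m Q) (maxn r.+1 s).
Proof.
exact (@regle_colon _ _ _ _ _ _ (mideal_hom K hQ) (mideal_hom K hQc) degX colonP sumP r s).
Qed.

Lemma regle_var_sum r s : regle (@mideal K m Qc) r -> regle (@mideal K m Q) s ->
  regle (@mideal K m Qs) (maxn r s).
Proof.
exact (@regle_sum _ _ _ _ _ _ (mideal_hom K hQ) (mideal_hom K hQc) degX colonP sumP r s
  (mideal_hom K hQs)).
Qed.
End Variable_step.

Lemma regle_zero : regle (@mideal K m pred0) 0.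
Proof.
pose X := @BasedComplex K m unit (fun=> 0%N) (fun=> 0%N) (fun _ _ => 0) (fun=> 1).
have epsE (v : X -> S) : eps v = v tt.
  by rewrite /eps /dot (bigD1 tt) //= mulr1 big1 ?addr0 // => -[].
exists X; split=> //; first split=> //; first split.
- by move=> b c; rewrite eqxx.
- by move=> b c; apply: isdeg0.
- by move=> b u; rewrite mcoeff1; case: (u =P 0%MM) => [->|]; rewrite ?mdeg0 ?eqxx.
- split; first split.
  + by move=> b c; rewrite /dif dot0.
  + by move=> b; rewrite epsE => u; rewrite mcoeff0 eqxx.
  + move=> v _; rewrite epsE => h; exists (fun=> 0) => -[].
    rewrite /dif dot0; apply/mpolyP => u; rewrite mcoeff0; apply/eqP.
    by apply/negP => /negP /h.
  + by exists (fun=> 1) => u; rewrite epsE subrr mcoeff0 eqxx.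
Qed.

Definition kill V (u : 'X_{1..m}) : bool := [exists i in V, u i != 0%N].
Definition edges e (u : 'X_{1..m}) : bool :=
  [exists i, exists j, [&& e i j, u i != 0%N & u j != 0%N]].
Definition graph_pred V e (u : 'X_{1..m}) : bool := kill V u || edges e u.

Lemma killP V u : reflect (exists2 i, i \in V & u i != 0%N) (kill V u).
Proof. exact: exists_inP. Qed.

Lemma edgesP e u :
  reflect (exists i j, [/\ e i j, u i != 0%N & u j != 0%N]) (edges e u).
Proof.
apply: (iffP existsP) => [[i /existsP[j /and3P[]]]|[i [j [h1 h2 h3]]]].
  by exists i, j.
by exists i; apply/existsP; exists j; rewrite h1 h2.
Qed.

Lemma mnmD_neq0 (u v : 'X_{1..m}) i : u i != 0%N -> (u + v)%MM i != 0%N.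
Proof. by rewrite mnmDE addn_eq0 negb_and => ->. Qed.

Lemma kill_upset V : upset (kill V).
Proof.
move=> u v /killP[i h1 h2]; apply/killP; exists i => //; exact: mnmD_neq0.
Qed.

Lemma edges_upset e : upset (edges e).
Proof.
move=> u v /edgesP[i [j [h1 h2 h3]]]; apply/edgesP; exists i, j.
by split=> //; apply: mnmD_neq0.
Qed.

Lemma graph_upset V e : upset (graph_pred V e).
Proof.
by move=> u v /orP[] h; apply/orP; [left; apply: kill_upset | right; apply: edges_upset].
Qed.

Lemma killU (i : 'I_m) V u : kill (i |: V) u = kill V u || (u i != 0%N).
Proof.
apply/killP/orP => [[j /setU1P[->|h1] h2]|[/killP[j h1 h2]|h]].
- by right.
- by left; apply/killP; exists j.
- by exists j => //; rewrite inE h1 orbT.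
- by exists i => //; rewrite setU11.
Qed.

Lemma kill_shift V (i : 'I_m) u : i \notin V -> kill V (U_(i) + u)%MM = kill V u.
Proof.
move=> hi; apply/killP/killP => -[j h1 h2]; exists j => //; last first.
  by rewrite addmC; apply: mnmD_neq0.
move: h2; rewrite mnmDE mnm1E; case: (eqVneq i j) h1 => [<-|//].
by rewrite (negbTE hi).
Qed.

(** The Koszul complex, built as iterated mapping cones. *)
Lemma regle_kill V : regle (@mideal K m (kill V)) 0.
Proof.
move: {2}#|V| (erefl #|V|) => k; elim: k V => [|k IH] V hV.
  apply: eq_regle regle_zero => u; apply/esym/negbTE/killP => -[i].
  by rewrite (cards0_eq hV) inE.
have [i hi] : exists i, i \in V by apply/card_gt0P; rewrite hV.
have e : V = i |: (V :\ i) by rewrite setD1K.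
have hk : #|V :\ i| = k by move: hV; rewrite (cardsD1 i) hi => -[].
have h := IH _ hk.
rewrite e -[0%N]/(maxn 0 0).
apply: (@regle_var_sum (kill (V :\ i)) (kill (V :\ i)) _ i) => //; try exact: kill_upset.
- by move=> u; rewrite kill_shift // setD11.
- by move=> u; rewrite killU.
Qed.

Section VertexStep.
Variables (e : rel 'I_m) (V : {set 'I_m}) (i : 'I_m).
Hypotheses (e_sym : ssrbool.symmetric e) (e_irr : irreflexive e) (hi : i \notin V).

Let N := [set j | e i j].

(** A monomial falls into the ideal after multiplication by a variable x outside
    V exactly when it already was there or is divisible by a neighbor of x. *)
Lemma graph_shift u : graph_pred (V :|: N) e u = graph_pred V e (U_(i) + u)%MM.
Proof.
have neq j : e i j -> i != j by apply: contraTneq => <-; rewrite e_irr.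
have val j : i != j -> (U_(i) + u)%MM j = u j.
  by move=> /negbTE h; rewrite mnmDE mnm1E h.
have nz : (U_(i) + u)%MM i != 0%N by rewrite mnmDE mnm1E eqxx.
have sub j : u j != 0%N -> (U_(i) + u)%MM j != 0%N.
  by rewrite addmC; apply: mnmD_neq0.
rewrite /graph_pred /= kill_shift //; apply/orP/orP.
  case=> [/killP[j /setUP[h|]]|/edgesP[j [k [h1 h2 h3]]]].
  - by move=> hu; left; apply/killP; exists j.
  - rewrite inE => h hu; right; apply/edgesP; exists i, j; rewrite nz.
    by split=> //; apply: sub.
  - by right; apply/edgesP; exists j, k; split=> //; apply: sub.
case=> [/killP[j h1 h2]|/edgesP[j [k [h1 h2 h3]]]].
  by left; apply/killP; exists j; rewrite // inE h1.
case: (eqVneq i j) h1 h2 => [<-|nj] h1 h2.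
  left; apply/killP; exists k; first by rewrite !inE h1 orbT.
  by rewrite -val // neq.
case: (eqVneq i k) h1 h3 => [<-|nk] h1 h3.
  left; apply/killP; exists j; first by rewrite !inE e_sym h1 orbT.
  by rewrite -val.
by right; apply/edgesP; exists j, k; rewrite -!val.
Qed.

Let sumE u : graph_pred (i |: V) e u = graph_pred V e u || (u i != 0%N).
Proof. by rewrite /graph_pred /= killU orbAC. Qed.

Lemma regle_graph_colon r s : regle (@mideal K m (graph_pred (V :|: N) e)) r ->
  regle (@mideal K m (graph_pred (i |: V) e)) s ->
  regle (@mideal K m (graph_pred V e)) (maxn r.+1 s).
Proof.
by apply: (@regle_var_colon _ _ _ i) graph_shift sumE _ _; apply: graph_upset.
Qed.

Lemma regle_graph_sum r s : regle (@mideal K m (graph_pred (V :|: N) e)) r ->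
  regle (@mideal K m (graph_pred V e)) s ->
  regle (@mideal K m (graph_pred (i |: V) e)) (maxn r s).
Proof.
by apply: (@regle_var_sum _ _ _ i) graph_shift sumE _ _; apply: graph_upset.
Qed.
End VertexStep.

(** As long as some edge avoids V, a vertex outside V with a neighbor outside V
    gives two larger sets; without such edges only the variables are left. *)
Lemma regle_graph e V : ssrbool.symmetric e -> irreflexive e ->
  exists r, regle (@mideal K m (graph_pred V e)) r.
Proof.
move=> e_sym e_irr; move: {2}#|~: V|.+1 (ltnSn #|~: V|) => k.
elim: k V => [//|k IH] V; rewrite ltnS => hk.
have [/existsP[i /andP[hi /subsetPn[j hj hjV]]]|h] :=
  boolP [exists i, (i \notin V) && ~~ ([set j | e i j] \subset V)].
  have step (W : {set 'I_m}) x : x \in W -> x \notin V -> V \subset W -> (#|~: W| < k)%N.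
    move=> h1 h2 h3; apply: leq_trans hk; apply: proper_card; apply/properP.
    by split; [rewrite setCS | exists x; rewrite !inE ?h1 ?h2].
  have [|r hr] := IH (V :|: [set j | e i j]).
    by apply: (step _ j) => //; [rewrite inE hj orbT | apply: subsetUl].
  have [|s hs] := IH (i |: V).
    by apply: (step _ i) => //; [apply: setU11 | apply: subsetUr].
  by exists (maxn r.+1 s); apply: regle_graph_colon hr hs.
exists 0%N; apply: eq_regle (regle_kill V) => u; rewrite /graph_pred /=.
apply/idP/orP => [->|[//|/edgesP[i [j [h1 h2 h3]]]]]; first by left.
have [hi|hi] := boolP (i \in V); first by apply/killP; exists i.
apply/killP; exists j => //.
move: h; rewrite negb_exists => /forallP/(_ i); rewrite hi negbK => /subsetP; apply.
by rewrite inE.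
Qed.

Lemma graph_pred0 V e : ~~ graph_pred V e 0%MM.
Proof.
by apply/negP => /orP[/killP[i _]|/edgesP[i [j [_]]]]; rewrite mnm0E.
Qed.

Lemma regle_hasreg_graph V e r : regle (@mideal K m (graph_pred V e)) r ->
  exists2 s, (s <= r)%N & hasreg (@mideal K m (graph_pred V e)) s.
Proof.
apply: regle_hasreg; first exact/mideal_ideal/graph_upset.
by move=> p; apply: mideal_const0; apply: graph_pred0.
Qed.

Lemma hasreg_min_graph V e r s : hasreg (@mideal K m (graph_pred V e)) r ->
  regle (@mideal K m (graph_pred V e)) s -> (r <= s)%N.
Proof.
apply: hasreg_min; first exact/mideal_hom/graph_upset.
by move=> p; apply: mideal_const0; apply: graph_pred0.
Qed.

Lemma hasreg_kill V : hasreg (@mideal K m (kill V)) 0.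
Proof.
have eK : kill V =1 graph_pred V (fun _ _ => false).
  move=> u; rewrite /graph_pred /= [edges _ u](_ : _ = false) ?orbF //.
  by apply/negbTE/edgesP => -[i [j []]].
have [s] := regle_hasreg_graph (eq_regle eK (regle_kill V)).
rewrite leqn0 => /eqP -> h; apply: eq_hasreg h => u; exact: esym (eK u).
Qed.

(** In a resolution with [tdeg <= hdeg], the generators in homological degree 0
    have constant augmentations, and the boundaries in degree 1 give relations
    of degree at most 1, which must be trivial. But a monomial of the ideal
    times a generator with nonzero augmentation is a combination of them. *)
Lemma regle0_linear Q u0 : upset Q -> Q u0 -> (forall u, Q u -> (1 < mdeg u)%N) ->
  ~ regle (@mideal K m Q) 0.
Proof.
move=> hQ Qu0 degQ [X [[[g1 g2] g3 g4] [[dd da ex] [w hw]] bX]].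
have bd0 b c : hdeg b = 0%N -> @bd _ _ X b c = 0.
  by move=> h; apply/eqP/negP => /negP /g1; rewrite h.
have rel0 b : hdeg b = 1%N -> eps (@bd _ _ X b) = 0.
  move=> hb; apply/mpolyP => u; rewrite mcoeff0; apply/eqP/negP => /negP h.
  have := degQ u (da b u h).
  have hu : (mdeg u + 0)%N = tdeg b.
    have /(_ u h) // : isdeg (eps (@bd _ _ X b)) (tdeg b) 0.
    by apply: isdeg_sum => c _; apply: isdegM (g2 b c) (g4 c).
  by rewrite -[mdeg u]addn0 hu ltnNge; have := bX b; rewrite addn0 hb => ->.
have [b hb] : exists b : X, baug b != 0.
  apply/existsP; apply: contraT; rewrite negb_exists => /forallP h.
  have : Q 0%MM.
    apply: hw; rewrite (_ : eps w = 0) ?subr0 ?mcoeff1 ?eqxx ?oner_eq0 //.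
    by apply: dot_eq0 => c _; apply/eqP; have := h c; rewrite negbK.
  by move/degQ; rewrite mdeg0.
have b0 := g3 b hb.
have [||v hv] := ex (fun c => 'X_[u0] * (c == b)%:R).
- by move=> c; rewrite /dif dotZ dot_delta bd0 ?mulr0.
- rewrite /eps dotZ dot_delta mulrC.
  by apply: (@idealM _ _ _ _ (mideal_ideal K hQ)); apply: midealX.
have : eps (fun c : X => 'X_[u0] * (c == b)%:R) = 0.
  rewrite /eps (eq_dot (w := dif v)) // dot_dot; apply: big1 => c _.
  have [h1|h1] := eqVneq (hdeg c) 1%N; first by rewrite [dot _ _]rel0 ?mulr0.
  rewrite [dot _ _](_ : _ = 0) ?mulr0 //; apply: dot_eq0 => a /g1 h.
  by apply/eqP; apply: contraNT h1 => /g3 ha; rewrite h ha.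
rewrite /eps dotZ dot_delta => /eqP; rewrite mulf_eq0 (negbTE hb) orbF.
by move/eqP/mpolyP/(_ u0)/eqP; rewrite mcoeffX eqxx mcoeff0 oner_eq0.
Qed.

Lemma edges_mdeg e u : irreflexive e -> edges e u -> (1 < mdeg u)%N.
Proof.
move=> e_irr /edgesP[i [j [h1 h2 h3]]]; rewrite mdegE (bigD1 i) //= (bigD1 j) /=.
  by rewrite addnA; apply: leq_trans (leq_addr _ _); case: (u i) h2 => //;
     case: (u j) h3 => // a _ b _; rewrite addSn addnS.
by apply: contraTneq h1 => ->; rewrite e_irr.
Qed.

Lemma regle0_edges e i j : irreflexive e -> e i j ->
  ~ regle (@mideal K m (graph_pred set0 e)) 0.
Proof.
move=> e_irr eij; apply: (@regle0_linear _ (U_(i) + U_(j))%MM).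
- exact: graph_upset.
- apply/orP; right; apply/edgesP; exists i, j; split=> //.
    by apply: mnmD_neq0; rewrite mnm1E eqxx.
  by rewrite addmC; apply: mnmD_neq0; rewrite mnm1E eqxx.
- move=> u /orP[/killP[k]|]; [by rewrite inE | exact: edges_mdeg].
Qed.
End Existence.

(** * Coronas of complete graphs *)

Section EdgeIdeals.
Variables (K : fieldType) (G : sgraph).
Local Notation S := {mpoly K[#|G|]}.

Definition graph_rel : rel 'I_#|G| := fun i j => adj (enum_val i) (enum_val j).

Lemma graph_rel_sym : ssrbool.symmetric graph_rel.
Proof. by move=> i j; apply: adj_sym. Qed.

Lemma graph_rel_irr : irreflexive graph_rel.
Proof. by move=> i; apply: adj_irr. Qed.

Lemma graph_relE (v w : G) : graph_rel (enum_rank v) (enum_rank w) = adj v w.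
Proof. by rewrite /graph_rel !enum_rankK. Qed.

Definition isolated_set : {set 'I_#|G|} := [set i | isolated (enum_val i)].

(** The ideal generated by monomials contains exactly the polynomials all of
    whose monomials are divisible by a generator. *)
Lemma edge_idealE :
  edge_ideal K G = mideal (graph_pred isolated_set graph_rel).
Proof.
have hQ : upset (graph_pred isolated_set graph_rel) by exact: graph_upset.
have hI := mideal_ideal K hQ.
apply: FunctionalExtensionality.functional_extensionality => p.
apply: PropExtensionality.propositional_extensionality; split.
  move=> [s hs ->]; rewrite big_seq; apply: (@ideal_sum _ _ _ _ _ _ hI) => t /hs h.
  apply: (@idealM _ _ _ _ hI); case: h => [[v [w [avw ->]]]|[v [iv ->]]].
    rewrite -mpolyXD; apply: midealX; apply/orP; right; apply/edgesP.
    exists (enum_rank v), (enum_rank w); rewrite graph_relE; split=> //.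
      by apply: mnmD_neq0; rewrite mnm1E eqxx.
    by rewrite addmC; apply: mnmD_neq0; rewrite mnm1E eqxx.
  apply: midealX; apply/orP; left; apply/killP; exists (enum_rank v).
    by rewrite inE enum_rankK.
  by rewrite mnm1E eqxx.
move=> hp.
have h u : exists g, p@_u != 0 -> (g <= u)%MM /\
   ((exists v w : G, adj v w /\ 'X_[g] = gvar K v * gvar K w) \/
    (exists v : G, isolated v /\ 'X_[g] = gvar K v)).
  have [e0|/hp hu] := eqVneq p@_u 0; first by exists 0%MM => /eqP [].
  case/orP: hu => [/killP[i]|/edgesP[i [j [h1 h2 h3]]]].
    rewrite inE => h1 h2; exists U_(i)%MM => _; split; first by rewrite lep1mP.
    by right; exists (enum_val i); rewrite /gvar enum_valK.
  exists (U_(i) + U_(j))%MM => _; split.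
    have nij : i != j by apply: contraTneq h1 => ->; rewrite graph_rel_irr.
    apply/mnm_lepP => k; rewrite mnmDE !mnm1E.
    case: (eqVneq i k) nij => [<-|_] nij; last first.
      by case: (eqVneq j k) => [<-|//]; rewrite lt0n.
    by rewrite eq_sym (negbTE nij) addn0 lt0n.
  by left; exists (enum_val i), (enum_val j); rewrite /gvar !enum_valK mpolyXD.
have [g hg] := choose_fun h.
exists [seq (p@_u *: 'X_[u - g u], 'X_[g u]) | u <- msupp p].
  move=> t /mapP[u hu ->] /=; apply: (hg u _).2; by rewrite -mcoeff_msupp.
rewrite big_map {1}[p]mpolyE big_seq [RHS]big_seq; apply: eq_bigr => u hu /=.
rewrite -scalerAl -mpolyXD submK //.
by case: (hg u); rewrite -?mcoeff_msupp.
Qed.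

(** Isolated vertices contribute variables to the edge ideal, in a tensor
    factor of regularity 0. *)
Lemma hasreg_edge_ideal s : hasreg (@mideal K _ (edges graph_rel)) s ->
  hasreg (edge_ideal K G) s.
Proof.
rewrite edge_idealE => h.
pose iota (j : 'I_#|isolated_set|) := enum_val j.
have iota_inj : injective iota by exact: enum_val_inj.
have h0 := hasreg_kill K [set: 'I_#|isolated_set|].
have := hasreg_tensor iota_inj (@edges_upset _ graph_rel)
  (@kill_upset _ [set: 'I_#|isolated_set|]) _ h h0.
rewrite addn0 => h1; apply: eq_hasreg (h1 _) => u.
  rewrite /= orbC /graph_pred; congr (_ || _).
  apply/killP/killP => [[j _]|[i hi ui]].
    by rewrite mnmE => hj; exists (iota j) => //; apply: enum_valP.
  exists (enum_rank_in hi i); first by rewrite inE.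
  by rewrite mnmE /iota enum_rankK_in.
move=> /edgesP[i [j [hij ui uj]]]; apply/edgesP; exists i, j.
have out k l : graph_rel k l -> preimage iota k = None.
  move=> hkl; rewrite /preimage; case: pickP => // a /eqP ea.
  have := enum_valP a; rewrite -/(iota a) ea inE => /forallP /(_ (enum_val l)).
  by rewrite -/(graph_rel k l) hkl.
by rewrite !mnmE (out _ _ hij) (out j i) // graph_rel_sym.
Qed.

Lemma edges_hasreg : exists s, hasreg (@mideal K _ (edges graph_rel)) s.
Proof.
have [r hr] := regle_graph K set0 graph_rel_sym graph_rel_irr.
have [s _ hs] := regle_hasreg_graph hr.
exists s; apply: eq_hasreg hs => u; rewrite /graph_pred.
by rewrite (_ : kill set0 u = false) //; apply/negbTE/killP => -[i]; rewrite inE.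
Qed.
End EdgeIdeals.

Section Corona.
Variables (K : fieldType) (n : nat) (H : sgraph).
Local Notation C := (corona (complete_graph n) H).
Local Notation M := #|C|.

Definition clique_index (i : 'I_n) : 'I_M := enum_rank (inl i : C).
Definition copy_index (i : 'I_n) (j : 'I_#|H|) : 'I_M :=
  enum_rank (inr (i, enum_val j) : C).

Lemma copy_index_inj i : injective (copy_index i).
Proof. by move=> j k /enum_rank_inj [] /enum_val_inj. Qed.

(** What the corona becomes when V contains every clique vertex that matters:
    the copies indexed by T, which no longer interact. *)
Definition copies_pred (V : {set 'I_M}) (T : {set 'I_n}) (u : 'X_{1..M}) : bool :=
  kill V u || [exists i in T, edges (@graph_rel H) (inner (copy_index i) u)].

Lemma copies_upset V T : upset (copies_pred V T).
Proof.
move=> u v /orP[h|/exists_inP[i iT h]]; apply/orP; first by left; apply: kill_upset.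
right; apply/exists_inP; exists i => //.
exact: (@inner_upset _ _ (copy_index i) _ (@edges_upset _ (@graph_rel H))) h.
Qed.

(** The copies of H use disjoint sets of variables, also disjoint from V. *)
Lemma hasreg_copies (V : {set 'I_M}) (T : {set 'I_n}) s :
  (forall i j, i \in T -> copy_index i j \notin V) ->
  hasreg (@mideal K _ (edges (@graph_rel H))) s ->
  hasreg (@mideal K M (copies_pred V T)) (#|T| * s).
Proof.
move=> hV hs; move: {2}#|T| (erefl #|T|) => k; elim: k T hV => [|k IH] T hV hk.
  rewrite hk; apply: eq_hasreg (hasreg_kill K V) => u.
  rewrite /copies_pred (cards0_eq hk) orbC.
  by case: exists_inP => // -[i]; rewrite inE.
have [i hi] : exists i, i \in T by apply/card_gt0P; rewrite hk.
have hk' : #|T :\ i| = k by move: hk; rewrite (cardsD1 i) hi => -[].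
have hV' a b : a \in T :\ i -> copy_index a b \notin V.
  by move=> /setD1P[_ ha]; apply: hV.
have h := IH _ hV' hk'.
rewrite (cardsD1 i) hi mulSn addnC.
have inj := @copy_index_inj i.
have := hasreg_tensor inj (@copies_upset V (T :\ i)) (@edges_upset _ (@graph_rel H)) _ h hs.
move=> h1; apply: eq_hasreg (h1 _) => u.
  rewrite /= /copies_pred -orbA; congr (_ || _); apply/orP/exists_inP.
    case=> [/exists_inP[a /setD1P[_ ha] ea]|ei]; first by exists a.
    by exists i.
  move=> [a ha ea]; have [e|na] := eqVneq a i; first by right; rewrite -e.
  by left; apply/exists_inP; exists a => //; rewrite !inE na.
have out b : (forall j, copy_index i j != b) -> outer (copy_index i) u b = u b.
  move=> hb; rewrite mnmE /preimage; case: pickP => // j /eqP e.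
  by have := hb j; rewrite e eqxx.
move=> /orP[/killP[b hb ub]|/exists_inP[a /setD1P[na ha] /edgesP[x [y [hxy ux uy]]]]].
  apply/orP; left; apply/killP; exists b => //.
  by rewrite out // => j; apply: contraTneq hb => <-; apply: hV.
apply/orP; right; apply/exists_inP; exists a; first by rewrite !inE na.
apply/edgesP; exists x, y; move: ux uy.
have neq z j : copy_index i j != copy_index a z.
  apply: contra na => /eqP /enum_rank_inj [-> _] //.
by rewrite ![inner _ _ _]mnmE !out.
Qed.

(** An edge that meets V is a multiple of a variable of V, hence redundant as a
    generator. *)
Lemma graph_pred_copies (V : {set 'I_M}) (T : {set 'I_n}) :
  (forall a b : C, adj a b -> [\/ enum_rank a \in V, enum_rank b \in V |
     exists i h k, [/\ i \in T, a = inr (i, h) & b = inr (i, k)]]) ->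
  graph_pred V (@graph_rel C) =1 copies_pred V T.
Proof.
move=> hT u; apply/orP/orP => -[h|].
- by left.
- move=> /edgesP[a [b [ab ua ub]]].
  have := hT _ _ ab; rewrite !enum_valK.
  case=> [ha|hb|[i [h [k [iT ea eb]]]]].
  + by left; apply/killP; exists a.
  + by left; apply/killP; exists b.
  right; apply/exists_inP; exists i => //; apply/edgesP.
  exists (enum_rank h), (enum_rank k); rewrite graph_relE !mnmE /copy_index !enum_rankK.
  rewrite -ea -eb !enum_valK; split=> //.
  by move: ab; rewrite /graph_rel ea eb /= => /andP[].
- by left.
- move=> /exists_inP[i iT /edgesP[h [k [hk uh uk]]]].
  right; apply/edgesP; exists (copy_index i h), (copy_index i k).
  move: uh uk; rewrite !mnmE graph_relE /= eqxx.
  by split.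
Qed.

Definition clique_prefix k : {set 'I_M} := [set clique_index i | i : 'I_n & (i < k)%N].

Lemma clique_index_inj : injective clique_index.
Proof. by move=> i j /enum_rank_inj []. Qed.

Lemma mem_clique_prefix k i : (clique_index i \in clique_prefix k) = (i < k)%N.
Proof. by rewrite mem_imset ?inE //; apply: clique_index_inj. Qed.

Lemma copy_clique i j a : copy_index i j != clique_index a.
Proof. by apply/eqP => /enum_rank_inj. Qed.

Lemma prefixS (k : 'I_n) :
  clique_prefix k.+1 = clique_index k |: clique_prefix k.
Proof.
apply/setP => x; rewrite in_setU1; apply/imsetP/predU1P.
  move=> [i]; rewrite inE ltnS leq_eqVlt => /predU1P[e ->|h ->].
    by left; congr clique_index; apply: val_inj.
  by right; apply: imset_f; rewrite inE.
case=> [->|/imsetP[i]]; first by exists k; rewrite ?inE.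
by rewrite inE => h ->; exists i => //; rewrite inE ltnW.
Qed.

Lemma graph_pred_prefix_all :
  graph_pred (clique_prefix n) (@graph_rel C) =1 copies_pred (clique_prefix n) setT.
Proof.
apply: graph_pred_copies => -[i|[i h]] [j|[j k]] /= hab.
- by constructor 1; rewrite mem_clique_prefix.
- by constructor 1; rewrite mem_clique_prefix.
- by constructor 2; rewrite mem_clique_prefix.
- move: hab => /andP[/eqP <- _]; constructor 3; exists i, h, k; split=> //.
  by rewrite inE.
Qed.

Let N (k : 'I_n) := [set x | @graph_rel C (clique_index k) x].

Lemma mem_nbr k (a : C) : (enum_rank a \in N k) = @adj C (inl k) a.
Proof. by rewrite inE graph_relE. Qed.

Lemma prefix_nbr (k : 'I_n) : clique_prefix k \subset N k.
Proof.
apply/subsetP => x /imsetP[i]; rewrite inE => hi ->.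
by rewrite mem_nbr /= /complete_adj; apply: contraTneq hi => ->; rewrite ltnn.
Qed.

(** Every edge outside the copies and every edge at the copy of k meets a neighbor
    of the k-th clique vertex. *)
Lemma graph_pred_colon (k : 'I_n) :
  graph_pred (clique_prefix k :|: N k) (@graph_rel C)
    =1 copies_pred (N k) [set~ k].
Proof.
rewrite (setUidPr (prefix_nbr k)).
apply: graph_pred_copies => a b hab.
have key (i : 'I_n) c : @adj C (inl i) c -> enum_rank (inl i : C) \in N k \/ enum_rank c \in N k.
  move=> h; rewrite !mem_nbr; have [e|ne] := eqVneq i k; first by right; rewrite -e.
  by left; rewrite /= /complete_adj eq_sym.
case: a hab => [i|[i h]] hab.
  by case: (key _ _ hab) => ?; [constructor 1 | constructor 2].
case: b hab => [j|[j h']] hab.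
  have hba : @adj C (inl j) (inr (i, h)) by rewrite adj_sym.
  by case: (key _ _ hba) => ?; [constructor 2 | constructor 1].
move: hab => /= /andP[/eqP <- _]; have [e|ne] := eqVneq i k.
  by constructor 1; rewrite mem_nbr /= e.
by constructor 3; exists i, h, h'; rewrite !inE.
Qed.

Lemma copy_nbr k i j : i \in [set~ k] -> copy_index i j \notin N k.
Proof. by rewrite !inE graph_relE /= eq_sym. Qed.

Lemma clique_notin_prefix (k : 'I_n) : clique_index k \notin clique_prefix k.
Proof. by rewrite mem_clique_prefix ltnn. Qed.

(** Downward induction on the number k of clique vertices set to zero. For
    k = n there remain n disjoint copies of H, of regularity n * s. Removing
    the vertex x from the set, the colon ideal by x is that of n - 1 copies
    of H, since all other vertices near x are set to zero; its regularity is
    smaller by s > 0, and the exact sequence of x leaves that of the quotient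
    unchanged. *)
Lemma hasreg_prefix s d : (0 < s)%N -> (d <= n)%N ->
  hasreg (@mideal K _ (edges (@graph_rel H))) s ->
  hasreg (@mideal K M (graph_pred (clique_prefix (n - d)) (@graph_rel C))) (n * s).
Proof.
move=> s0 + hs; elim: d => [_|d IH hd].
  have := @hasreg_copies (clique_prefix n) setT s; rewrite cardsT card_ord subn0 => h.
  apply: eq_hasreg (h _ hs) => [u|i j _]; first by rewrite graph_pred_prefix_all.
  by apply/imsetP => -[a _]; apply/eqP/copy_clique.
have hkn : (n - d.+1 < n)%N by rewrite ltn_subrL /= (leq_ltn_trans _ hd).
pose k := Ordinal hkn.
have ek : (n - d)%N = k.+1 by rewrite /= subnSK.
have {IH} := IH (ltnW hd); rewrite ek prefixS => hC.
have hA : hasreg (@mideal K M (graph_pred (clique_prefix k :|: N k) (@graph_rel C)))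
    (n.-1 * s).
  have := @hasreg_copies (N k) [set~ k] s; rewrite cardsC1 card_ord => h.
  apply: eq_hasreg (h _ hs) => [u|i j]; first by rewrite graph_pred_colon.
  exact: copy_nbr.
have rA := hasreg_regle hA; have rC := hasreg_regle hC.
have ns : (n.-1 * s + s = n * s)%N by rewrite -mulSnr prednK // (leq_ltn_trans _ hd).
have [t ht hI] := regle_hasreg_graph (regle_graph_colon (@graph_rel_sym C)
   (@graph_rel_irr C) (clique_notin_prefix k) rA rC).
have := hasreg_min_graph hC (regle_graph_sum (@graph_rel_sym C)
   (@graph_rel_irr C) (clique_notin_prefix k) rA (hasreg_regle hI)).
move: ht; rewrite !leq_max => ht1 ht2.
suff -> : (n * s)%N = t by [].
lia.
Qed.

(** The same induction as for [hasreg_prefix]. Without edges in the copies, the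
    colon ideals are generated by variables and contribute 1. *)
Lemma regle_prefix_null d : null_graph H -> (d <= n)%N ->
  regle (@mideal K M (graph_pred (clique_prefix (n - d)) (@graph_rel C))) 1.
Proof.
move=> nullH; have no u : edges (@graph_rel H) u = false.
  apply/negbTE/edgesP => -[i [j [hij _ _]]]; move: hij.
  by move/forallP: nullH => /(_ (enum_val i)) /forallP /(_ (enum_val j)) /negbTE;
    rewrite /graph_rel => ->.
have copiesE V T : copies_pred V T =1 kill V.
  move=> u; rewrite /copies_pred; case: exists_inP => [[i _]|_]; last by rewrite orbF.
  by rewrite no.
elim: d => [_|d IH hd].
  rewrite subn0; apply: regle_leq (leq0n 1) _.
  apply: eq_regle (regle_kill K (clique_prefix n)) => u.
  by rewrite graph_pred_prefix_all copiesE.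
have hkn : (n - d.+1 < n)%N by rewrite ltn_subrL /= (leq_ltn_trans _ hd).
pose k := Ordinal hkn.
have ek : (n - d)%N = k.+1 by rewrite /= subnSK.
have {IH} := IH (ltnW hd); rewrite ek prefixS => rC.
have rA : regle (@mideal K M (graph_pred (clique_prefix k :|: N k) (@graph_rel C))) 0.
  by apply: eq_regle (regle_kill K (N k)) => u; rewrite graph_pred_colon copiesE.
exact: (regle_graph_colon (@graph_rel_sym C) (@graph_rel_irr C)
   (clique_notin_prefix k) rA rC).
Qed.

Lemma corona_isolated (hH : (0 < #|H|)%N) : @isolated_set C = set0.
Proof.
have /card_gt0P[h _] := hH.
apply/setP => x; rewrite !inE; apply/negbTE/forallPn.
case: (enum_val x) => [i|[i j]].
  by exists (inr (i, h)); rewrite negbK /= eqxx.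
by exists (inl i); rewrite negbK /= eqxx.
Qed.

Lemma prefix0 : clique_prefix 0 = set0.
Proof. by apply/setP => x; rewrite inE; apply/imsetP => -[i]; rewrite inE ltn0. Qed.

Lemma corona_edge_ideal (hH : (0 < #|H|)%N) :
  edge_ideal K C = mideal (graph_pred (clique_prefix (n - n)) (@graph_rel C)).
Proof. by rewrite edge_idealE corona_isolated // subnn prefix0. Qed.
End Corona.

Theorem theorem2p32 (K : fieldType) (n : nat) (H : sgraph)
    (hn : (1 <= n)%N) (hH : (0 < #|H|)%N) :
  reg (edge_ideal K (corona (complete_graph n) H)) =
    if null_graph H then 1 else n%:Z * reg (edge_ideal K H).
Proof.
rewrite (corona_edge_ideal K n hH); set I := mideal _.
have hI : hom_ideal I by apply/mideal_hom/graph_upset.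
case: ifP => nullH.
  have [t t1 ht] := regle_hasreg_graph (regle_prefix_null K nullH (leqnn n)).
  rewrite (hasreg_reg hI ht); case: t t1 ht => [_ ht|[|//] _ _ //].
  have /card_gt0P[h _] := hH; pose i : 'I_n := Ordinal hn.
  case: (@regle0_edges K _ (@graph_rel (corona (complete_graph n) H))
    (enum_rank (inl i : corona (complete_graph n) H))
    (enum_rank (inr (i, h) : corona (complete_graph n) H))).
  - exact: graph_rel_irr.
  - by rewrite graph_relE /= eqxx.
  - by move: (hasreg_regle ht); rewrite subnn prefix0.
have [s hs] := edges_hasreg K H.
have s0 : (0 < s)%N.
  case: s hs => // hs.
  move/negbT: nullH; rewrite negb_forall => /existsP[v]; rewrite negb_forall.
  move=> /existsP[w]; rewrite negbK -graph_relE => hvw.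
  case: (regle0_edges (K := K) (@graph_rel_irr H) hvw).
  apply: eq_regle (hasreg_regle hs) => u; rewrite /graph_pred.
  by rewrite (_ : kill set0 u = false) //; apply/negbTE/killP => -[i]; rewrite inE.
have hHom : hom_ideal (edge_ideal K H).
  by rewrite edge_idealE; apply/mideal_hom/graph_upset.
rewrite (hasreg_reg hHom (hasreg_edge_ideal hs)).
by rewrite (hasreg_reg hI (hasreg_prefix s0 (leqnn n) hs)) PoszM.
Qed.
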